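(* (i) For each $m\in\mathbb Z$, the $\mathbb Q(q^{1/2})$-algebra homomorphism $\mathbf L_m:U^-_{q^{1/2}}(\mathfrak g)\to\widehat{\mathcal A}[m]$ given by $f_i\mapsto f_{i,m}$ is an isomorphism. (ii) For any $a,b\in\mathbb Z$ with $a\le b$, the $\mathbb Q(q^{1/2})$-linear map $$\widehat{\mathcal A}[b]\otimes_{\mathbb Q(q^{1/2})}\widehat{\mathcal A}[b-1]\otimes_{\mathbb Q(q^{1/2})}\cdots\otimes_{\mathbb Q(q^{1/2})}\widehat{\mathcal A}[a+1]\otimes_{\mathbb Q(q^{1/2})}\widehat{\mathcal A}[a]\to\widehat{\mathcal A}[a,b]$$ defined by $x_b\otimes x_{b-1}\otimes\cdots\otimes x_{a+1}\otimes x_a\mapsto x_bx_{b-1}\cdots x_{a+1}x_a$ is an isomorphism.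
   Context: Root data. $C=(c_{i,j})_{i,j\in I}$ is a symmetrizable generalized Cartan matrix with weight lattice $P$, simple roots $\alpha_i\in P$, simple coroots $h_i\in \mathrm{Hom}_{\mathbb Z}(P,\mathbb Z)$, $\langle h_i,\alpha_j\rangle=c_{i,j}$, and a symmetric $\mathbb Q$-valued bilinear form $(\ ,\ )$ on $P$ with $(\alpha_i,\alpha_i)\in2\mathbb Z_{>0}$ and $\langle h_i,\lambda\rangle=2(\alpha_i,\lambda)/(\alpha_i,\alpha_i)$. $q$ is an indeterminate with square root $q^{1/2}$; $q_i=q^{(\alpha_i,\alpha_i)/2}$, $[n]_i=(q_i^n-q_i^{-n})/(q_i-q_i^{-1})$, with the usual binomials $\begin{bmatrix}m\\ n\end{bmatrix}_i$. $U_q^-(\mathfrak g)$ is the $\mathbb Q(q)$-algebra generated by the Chevalley generators $f_i$ ($i\in I$) of the negative half of the quantum group (quantum Serre relations), and $U^-_{q^{1/2}}(\mathfrak g)=\mathbb Q(q^{1/2})\otimes_{\mathbb Q(q)}U_q^-(\mathfrak g)$. $\widehat{\mathcal A}$ is the $\mathbb Q(q^{1/2})$-algebra generated by $f_{i,p}$ ($i\in I,p\in\mathbb Z$) with relations: (a) $\sum_{k=0}^{1-\langle h_i,\alpha_j\rangle}(-1)^k\begin{bmatrix}1-\langle h_i,\alpha_j\rangle\\k\end{bmatrix}_if_{i,p}^kf_{j,p}f_{i,p}^{1-\langle h_i,\alpha_j\rangle-k}=0$ for $i\ne j$, $p\in\mathbb Z$; (b) $f_{i,m}f_{j,p}=q^{(-1)^{p-m+1}(\alpha_i,\alpha_j)}f_{j,p}f_{i,m}+\delta_{(j,p),(i,m+1)}(1-q_i^2)$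 if $m<p$. $\widehat{\mathcal A}[a,b]$ is the $\mathbb Q(q^{1/2})$-subalgebra of $\widehat{\mathcal A}$ generated by $\{f_{i,k}\mid i\in I,\ a\le k\le b\}$, and $\widehat{\mathcal A}[m]=\widehat{\mathcal A}[m,m]$. *)

(* Defs.v *)
From HB Require Import structures.
From mathcomp Require Import all_boot all_order all_algebra.
From mathcomp Require Import generic_quotient ring_quotient finmap boolp.
From mathcomp.multinomials Require Export monalg.

Set Implicit Arguments.
Unset Strict Implicit.
Unset Printing Implicit Defensive.

Import Order.TTheory GRing.Theory Num.Theory.
Local Open Scope ring_scope.
Local Open Scope quotient_scope.

(* Operations below are sealed with this key, as conversion would otherwise unfold
   them at great cost when terms differ. *)
Fact seal_key : unit. Proof. exact: tt. Qed.

Section QuotientModule.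
Variables (R : nzRingType) (V : lmodType R) (S : V -> Prop).

Inductive span : V -> Prop :=
| span0 : span 0
| span_cons (a : R) (u v : V) : S u -> span v -> span (a *: u + v).

Lemma span_incl u : S u -> span u.
Proof. by move=> Su; rewrite -[u]addr0 -[u]scale1r; apply/span_cons/span0. Qed.

Lemma spanD u v : span u -> span v -> span (u + v).
Proof.
elim=> [|a x y Sx _ IH] sv; first by rewrite add0r.
by rewrite -addrA; apply/span_cons/IH.
Qed.

Lemma spanZ a u : span u -> span (a *: u).
Proof.
elim=> [|b x y Sx _ IH]; first by rewrite scaler0; apply: span0.
by rewrite scalerDr scalerA; apply: span_cons.
Qed.

Definition in_span : {pred V} := fun v => `[< span v >].

Lemma in_spanP v : reflect (span v) (v \in in_span).
Proof. exact: asboolP. Qed.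

Lemma in_span_submod_closed : submod_closed in_span.
Proof.
split; first exact/in_spanP/span0.
by move=> a u v /in_spanP su /in_spanP sv; apply/in_spanP/spanD => //; apply: spanZ.
Qed.

HB.instance Definition _ :=
  GRing.isSubmodClosed.Build R V in_span in_span_submod_closed.

Definition quotmod := Quotient.quot in_span.

HB.instance Definition _ := GRing.Zmodule.on quotmod.
HB.instance Definition _ := EqQuotient.on quotmod.

Definition qproj (v : V) : quotmod := \pi_quotmod v.

Lemma qprojP u v : qproj u = qproj v <-> span (u - v).
Proof.
rewrite /qproj; split.
  by move=> /eqP; rewrite -Quotient.idealrBE => /in_spanP.
by move=> /in_spanP; rewrite Quotient.idealrBE => /eqP.
Qed.

Lemma qproj_surj (x : quotmod) : exists v, x = qproj v.
Proof. by exists (repr x); rewrite /qproj reprK. Qed.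

Lemma qproj0 : qproj 0 = 0.
Proof. by rewrite /qproj !piE. Qed.

Lemma qprojD u v : qproj (u + v) = qproj u + qproj v.
Proof. by rewrite /qproj !piE. Qed.

Lemma qproj_repr v : span (v - repr (qproj v)).
Proof. by apply/qprojP; rewrite /qproj reprK. Qed.

Definition qscale : R -> quotmod -> quotmod :=
  locked_with seal_key (fun a x => qproj (a *: repr x)).
Canonical qscale_unlockable := [unlockable fun qscale].

Lemma qscaleE a v : qscale a (qproj v) = qproj (a *: v).
Proof.
rewrite unlock; apply/qprojP; rewrite -scalerBr; apply: spanZ.
by rewrite -opprB -scaleN1r; apply/spanZ/qproj_repr.
Qed.

Lemma qscalerA a b x : qscale a (qscale b x) = qscale (a * b) x.
Proof. by have [v ->] := qproj_surj x; rewrite !qscaleE scalerA. Qed.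
Lemma qscale1r : left_id 1 qscale.
Proof. by move=> x; have [v ->] := qproj_surj x; rewrite qscaleE scale1r. Qed.
Lemma qscalerDr : right_distributive qscale +%R.
Proof.
move=> a x y; have [u ->] := qproj_surj x; have [v ->] := qproj_surj y.
by rewrite -qprojD !qscaleE scalerDr qprojD.
Qed.
Lemma qscalerDl x : {morph qscale^~ x : a b / a + b}.
Proof. by move=> a b; have [u ->] := qproj_surj x; rewrite !qscaleE scalerDl qprojD. Qed.

HB.instance Definition _ := GRing.Zmodule_isLmodule.Build R quotmod
  qscalerA qscale1r qscalerDr qscalerDl.

Lemma qproj_is_linear : linear qproj.
Proof. by move=> a u v; rewrite qprojD -qscaleE. Qed.
HB.instance Definition _ :=
  GRing.isLinear.Build R V quotmod *:%R qproj qproj_is_linear.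

End QuotientModule.

(* The free algebra: the monoid algebra of the free monoid. Its operations are
   those of [malg], sealed for the same reason. *)
HB.lock Definition malg_mul (K : monomType) (R : nzRingType)
  (x y : {malg R[K]}) : {malg R[K]} := x * y.
HB.lock Definition malg_scale (K : monomType) (R : nzRingType)
  (a : R) (x : {malg R[K]}) : {malg R[K]} := a *: x.

Definition freealg (R : comNzRingType) (G : choiceType) : Type :=
  {malg R[{fmonom G}]}.

Section FreeAlgebra.
Variables (R : comNzRingType) (G : choiceType).
Notation M := {malg R[{fmonom G}]}.
HB.instance Definition _ := GRing.Zmodule.on (freealg R G).

Lemma free_mulA : associative (@malg_mul {fmonom G} R).
Proof. by move=> x y z; rewrite malg_mul.unlock; exact: mulrA. Qed.
Lemma free_mul1r : left_id (1 : M) (@malg_mul {fmonom G} R).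
Proof. by move=> x; rewrite malg_mul.unlock; exact: mul1r. Qed.
Lemma free_mulr1 : right_id (1 : M) (@malg_mul {fmonom G} R).
Proof. by move=> x; rewrite malg_mul.unlock; exact: mulr1. Qed.
Lemma free_mulDl : left_distributive (@malg_mul {fmonom G} R) +%R.
Proof. by move=> x y z; rewrite malg_mul.unlock; exact: mulrDl. Qed.
Lemma free_mulDr : right_distributive (@malg_mul {fmonom G} R) +%R.
Proof. by move=> x y z; rewrite malg_mul.unlock; exact: mulrDr. Qed.
Lemma free_oner_neq0 : (1 : M) != 0.
Proof. exact: oner_neq0. Qed.

HB.instance Definition _ := GRing.Zmodule_isNzRing.Build (freealg R G)
  free_mulA free_mul1r free_mulr1 free_mulDl free_mulDr free_oner_neq0.

Lemma free_scalerA a b (x : M) :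
  malg_scale a (malg_scale b x) = malg_scale (a * b) x.
Proof. by rewrite malg_scale.unlock; exact: scalerA. Qed.
Lemma free_scale1r : left_id 1 (@malg_scale {fmonom G} R).
Proof. by move=> x; rewrite malg_scale.unlock; exact: scale1r. Qed.
Lemma free_scalerDr : right_distributive (@malg_scale {fmonom G} R) +%R.
Proof. by move=> a x y; rewrite malg_scale.unlock; exact: scalerDr. Qed.
Lemma free_scalerDl (x : M) : {morph (@malg_scale {fmonom G} R)^~ x : a b / a + b}.
Proof. by move=> a b; rewrite malg_scale.unlock; exact: scalerDl. Qed.

HB.instance Definition _ := GRing.Zmodule_isLmodule.Build R (freealg R G)
  free_scalerA free_scale1r free_scalerDr free_scalerDl.

Lemma free_scalerAl (a : R) (x y : freealg R G) : a *: (x * y) = (a *: x) * y.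
Proof.
rewrite -[LHS]/(malg_scale a (malg_mul x y)) -[RHS]/(malg_mul (malg_scale a x) y).
by rewrite malg_mul.unlock malg_scale.unlock; exact: scalerAl.
Qed.
HB.instance Definition _ := GRing.Lmodule_isLalgebra.Build R (freealg R G)
  free_scalerAl.

Lemma malgC_central (a : R) (x : M) : a%:MP * x = x * a%:MP.
Proof.
apply/malgP => k; rewrite [LHS]mcoeffCM.
rewrite (mcoeffMrw k (fsubset_refl _) (msuppC_le a)) big_seq_fset1.
rewrite {1}[x]monalgE raddf_sum mulr_sumr; apply: eq_bigr => /= i _.
by rewrite mcoeffU mcoeffC eqxx mulr1n mulm1 mulrnAr mulrC.
Qed.

Lemma free_scalerAr (a : R) (x y : freealg R G) : a *: (x * y) = x * (a *: y).
Proof.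
rewrite -[LHS]/(malg_scale a (malg_mul x y)) -[RHS]/(malg_mul x (malg_scale a y)).
rewrite malg_mul.unlock malg_scale.unlock -[LHS]mul_malgC -(mul_malgC a y).
by rewrite [LHS]mulrA malgC_central -[LHS]mulrA.
Qed.
HB.instance Definition _ := GRing.Lalgebra_isAlgebra.Build R (freealg R G)
  free_scalerAr.

Definition freegen (g : G) : freealg R G := << fmu g >>.

Lemma freealg_mulE (x y : freealg R G) : x * y = (x : M) * (y : M) :> M.
Proof. by rewrite -[LHS]/(malg_mul x y) malg_mul.unlock. Qed.
Lemma freealg_scaleE a (x : freealg R G) : a *: x = a *: (x : M) :> M.
Proof. by rewrite -[LHS]/(malg_scale a x) malg_scale.unlock. Qed.
End FreeAlgebra.

Arguments freegen R {G} g.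

Section PresentedAlgebra.
Variables (R : comNzRingType) (G : choiceType).
Variable rel : freealg R G -> Prop.

(* The span of these elements is the two-sided ideal generated by [rel]. *)
Definition ideal_gen (x : freealg R G) : Prop :=
  exists a r b, rel r /\ x = a * r * b.

Lemma span_ideal_mull a x : span ideal_gen x -> span ideal_gen (a * x).
Proof.
elim=> [|c u v [a' [r [b [rr ->]]]] _ IH]; first by rewrite mulr0; apply: span0.
rewrite mulrDr -scalerAr; apply: span_cons IH.
by exists (a * a'), r, b; rewrite !mulrA.
Qed.

Lemma span_ideal_mulr a x : span ideal_gen x -> span ideal_gen (x * a).
Proof.
elim=> [|c u v [a' [r [b [rr ->]]]] _ IH]; first by rewrite mul0r; apply: span0.
rewrite mulrDl -scalerAl; apply: span_cons IH.
by exists a', r, (b * a); rewrite !mulrA.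
Qed.

(* The R-algebra with generators G and relations r = 0 for [rel r]. MathComp's
   algType demands 1 != 0, which cannot be known for arbitrary relations, so the
   algebra is a pzRingType and an lmodType R, together with pres_scalerAl/Ar. *)
Definition presalg := quotmod ideal_gen.
HB.instance Definition _ := GRing.Lmodule.on presalg.

Definition presone : presalg := qproj ideal_gen 1.
Definition presmul : presalg -> presalg -> presalg :=
  locked_with seal_key (fun x y => qproj ideal_gen (repr x * repr y)).
Canonical presmul_unlockable := [unlockable fun presmul].

Lemma presmulE u v :
  presmul (qproj ideal_gen u) (qproj ideal_gen v) = qproj ideal_gen (u * v).
Proof.
rewrite unlock; apply/esym/qprojP; set u' := repr _; set v' := repr _.
have -> : u * v - u' * v' = (u - u') * v + u' * (v - v').
  by rewrite mulrBl mulrBr addrA subrK.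
by apply: spanD; [apply: span_ideal_mulr|apply: span_ideal_mull];
  apply: qproj_repr.
Qed.

Lemma presmulA : associative presmul.
Proof.
move=> x y z; have [u ->] := qproj_surj x; have [v ->] := qproj_surj y.
by have [w ->] := qproj_surj z; rewrite !presmulE mulrA.
Qed.
Lemma presmul1r : left_id presone presmul.
Proof. by move=> x; have [u ->] := qproj_surj x; rewrite presmulE mul1r. Qed.
Lemma presmulr1 : right_id presone presmul.
Proof. by move=> x; have [u ->] := qproj_surj x; rewrite presmulE mulr1. Qed.
Lemma presmulDl : left_distributive presmul +%R.
Proof.
move=> x y z; have [u ->] := qproj_surj x; have [v ->] := qproj_surj y.
by have [w ->] := qproj_surj z; rewrite -qprojD !presmulE mulrDl qprojD.
Qed.
Lemma presmulDr : right_distributive presmul +%R.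
Proof.
move=> x y z; have [u ->] := qproj_surj x; have [v ->] := qproj_surj y.
by have [w ->] := qproj_surj z; rewrite -qprojD !presmulE mulrDr qprojD.
Qed.

HB.instance Definition _ := GRing.Zmodule_isPzRing.Build presalg
  presmulA presmul1r presmulr1 presmulDl presmulDr.

Definition presproj (u : freealg R G) : presalg := qproj ideal_gen u.

Lemma presproj_is_linear : linear presproj.
Proof. exact: qproj_is_linear. Qed.
HB.instance Definition _ :=
  GRing.isLinear.Build R (freealg R G) presalg *:%R presproj presproj_is_linear.

Lemma presproj_is_monoid_morphism : monoid_morphism presproj.
Proof. by split; [|move=> u v; apply: esym; apply: presmulE]. Qed.
HB.instance Definition _ := GRing.isMonoidMorphism.Build (freealg R G) presalg
  presproj presproj_is_monoid_morphism.

Lemma presproj_surj (x : presalg) : exists u, x = presproj u.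
Proof. exact: qproj_surj. Qed.

Lemma presproj_rel r : rel r -> presproj r = 0.
Proof.
move=> rr; rewrite -(linear0 presproj); apply/qprojP; rewrite subr0.
by apply: span_incl; exists 1, r, 1; rewrite mul1r mulr1.
Qed.

Lemma pres_scalerAl (a : R) (x y : presalg) : a *: (x * y) = (a *: x) * y.
Proof.
have [u ->] := presproj_surj x; have [v ->] := presproj_surj y.
by rewrite -rmorphM -!linearZ -rmorphM scalerAl.
Qed.
Lemma pres_scalerAr (a : R) (x y : presalg) : a *: (x * y) = x * (a *: y).
Proof.
have [u ->] := presproj_surj x; have [v ->] := presproj_surj y.
by rewrite -rmorphM -!linearZ -rmorphM scalerAr.
Qed.

Definition presgen (g : G) : presalg := presproj (freegen R g).

End PresentedAlgebra.

Section GeneratedSubalgebra.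
Variables (R : comNzRingType) (G : choiceType) (rel : freealg R G -> Prop).
Variable S : presalg rel -> Prop.

Inductive gen_subalg : presalg rel -> Prop :=
| gen_incl x : S x -> gen_subalg x
| gen_one : gen_subalg 1
| gen_lin (a : R) x y : gen_subalg x -> gen_subalg y -> gen_subalg (a *: x + y)
| gen_mul x y : gen_subalg x -> gen_subalg y -> gen_subalg (x * y).

Definition in_subalg : {pred presalg rel} := fun x => `[< gen_subalg x >].

Lemma in_subalgP x : reflect (gen_subalg x) (x \in in_subalg).
Proof. exact: asboolP. Qed.

Lemma in_subalg_submod_closed : submod_closed in_subalg.
Proof.
split.
  apply/in_subalgP; rewrite -(addNr 1) -scaleN1r.
  by apply: gen_lin; apply: gen_one.
by move=> a u v /in_subalgP su /in_subalgP sv; apply/in_subalgP/gen_lin.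
Qed.
HB.instance Definition _ :=
  GRing.isSubmodClosed.Build R (presalg rel) in_subalg in_subalg_submod_closed.

Lemma in_subalg_mulr_closed : mulr_closed in_subalg.
Proof.
split; first exact/in_subalgP/gen_one.
by move=> u v /in_subalgP su /in_subalgP sv; apply/in_subalgP/gen_mul.
Qed.
HB.instance Definition _ :=
  GRing.isMulClosed.Build (presalg rel) in_subalg in_subalg_mulr_closed.

Definition subalg := {x : presalg rel | x \in in_subalg}.
HB.instance Definition _ := SubChoice.on subalg.
HB.instance Definition _ := [SubChoice_isSubZmodule of subalg by <:].
HB.instance Definition _ := GRing.SubZmodule_isSubPzRing.Build
  (presalg rel) in_subalg subalg (subringClosedP _).
HB.instance Definition _ := [SubZmodule_isSubLmodule of subalg by <:].
End GeneratedSubalgebra.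

Section TensorProduct.
Variables (R : comNzRingType) (V W : lmodType R).

Definition tpair (v : V) (w : W) : {malg R[(V * W)%type]} := << (v, w) >>.

Variant tensor_rel : {malg R[(V * W)%type]} -> Prop :=
| tensor_linl (a : R) v v' w :
    tensor_rel (tpair (a *: v + v') w - (a *: tpair v w + tpair v' w))
| tensor_linr (a : R) v w w' :
    tensor_rel (tpair v (a *: w + w') - (a *: tpair v w + tpair v w')).

Definition tensor := quotmod tensor_rel.
HB.instance Definition _ := GRing.Lmodule.on tensor.

Definition tens : V -> W -> tensor :=
  locked_with seal_key (fun v w => qproj tensor_rel (tpair v w)).
Canonical tens_unlockable := [unlockable fun tens].

Lemma tens_linl w : linear (tens^~ w).
Proof.
move=> a v v'; rewrite unlock -qproj_is_linear.
by apply/qprojP/span_incl/tensor_linl.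
Qed.

Lemma tens_linr v : linear (tens v).
Proof.
move=> a w w'; rewrite unlock -qproj_is_linear.
by apply/qprojP/span_incl/tensor_linr.
Qed.

Lemma tensZl a v w : tens (a *: v) w = a *: tens v w.
Proof.
have D := tens_linl w; have t0 : tens 0 w = 0.
  by have := D (-1) 0 0; rewrite scaler0 addr0 scaleN1r addNr.
by have := D a v 0; rewrite !addr0 t0 addr0.
Qed.

Lemma tensZr a v w : tens v (a *: w) = a *: tens v w.
Proof.
have D := tens_linr v; have t0 : tens v 0 = 0.
  by have := D (-1) 0 0; rewrite scaler0 addr0 scaleN1r addNr.
by have := D a w 0; rewrite !addr0 t0 addr0.
Qed.

Lemma malg_span (g : {malg R[(V * W)%type]}) :
  g = \sum_(k <- msupp g) g@_k *: tpair k.1 k.2.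
Proof.
rewrite {1}[g]monalgE; apply: eq_bigr => -[v w] _ /=.
by apply/malgP=> k; rewrite mcoeffZ !mcoeffU mulr_natr.
Qed.

Lemma tensor_ind (P : tensor -> Prop) :
  P 0 -> (forall v w t, P t -> P (tens v w + t)) -> forall t, P t.
Proof.
move=> P0 PD t; have [g ->] := qproj_surj t; rewrite [g]malg_span.
elim/big_rec: _ => [|[v w] h _ IH]; first by rewrite qproj0.
rewrite qprojD /=; have -> : qproj tensor_rel (g@_(v, w) *: tpair v w)
    = tens (g@_(v, w) *: v) w.
  by rewrite tensZl unlock -[LHS]qscaleE.
exact: PD.
Qed.

Section Lift.
Variables (M : lmodType R) (f : V -> W -> M).

(* The linear map sending [tens v w] to [f v w], when f is bilinear. *)
Definition malglift (g : {malg R[(V * W)%type]}) : M :=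
  \sum_(k <- msupp g) g@_k *: f k.1 k.2.
Definition tlift : tensor -> M := locked_with seal_key (fun t => malglift (repr t)).
Canonical tlift_unlockable := [unlockable fun tlift].

Lemma malgliftEw (d : {fset (V * W)%type}) g : (msupp g `<=` d)%fset ->
  malglift g = \sum_(k <- d) g@_k *: f k.1 k.2.
Proof.
move=> le; rewrite [LHS](big_fset_incl _ le) => //= x xd /mcoeff_outdom ->.
by rewrite scale0r.
Qed.

Lemma malglift_linear : linear malglift.
Proof.
move=> a g h; pose d := (msupp g `|` msupp h)%fset.
rewrite !(@malgliftEw d) ?fsubsetUl ?fsubsetUr //; last first.
  apply: fsubset_trans (msuppD_le _ _) _; apply: fsetSU; exact: msuppZ_le.
rewrite scaler_sumr -big_split /=; apply: eq_bigr => k _.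
by rewrite mcoeffD mcoeffZ scalerDl scalerA.
Qed.

HB.instance Definition _ :=
  GRing.isLinear.Build R _ M *:%R malglift malglift_linear.

Lemma malglift_pair v w : malglift (tpair v w) = f v w.
Proof.
rewrite (@malgliftEw [fset (v, w)]%fset) ?msuppU_le //.
by rewrite big_seq_fset1 mcoeffUU scale1r.
Qed.

Hypothesis fl : forall w, linear (f^~ w).
Hypothesis fr : forall v, linear (f v).

Lemma malglift_rel g : span tensor_rel g -> malglift g = 0.
Proof.
elim=> [|a u v Su _ IH]; first exact: linear0.
rewrite malglift_linear IH addr0.
by case: Su => [b x x' y|b x y y'];
  rewrite raddfB /= malglift_linear !malglift_pair ?fl ?fr subrr scaler0.
Qed.

Lemma tlift_qproj g : tlift (qproj _ g) = malglift g.
Proof.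
apply/eqP; rewrite -subr_eq0 unlock -raddfB /=; apply/eqP/malglift_rel.
by rewrite -opprB -scaleN1r; apply/spanZ/qproj_repr.
Qed.

Lemma tliftE v w : tlift (tens v w) = f v w.
Proof. by rewrite [tens]unlock tlift_qproj malglift_pair. Qed.

Lemma tlift_linear : linear tlift.
Proof.
move=> a s t; have [g ->] := qproj_surj s; have [h ->] := qproj_surj t.
by rewrite -qproj_is_linear !tlift_qproj malglift_linear.
Qed.

Lemma tliftD s t : tlift (s + t) = tlift s + tlift t.
Proof. by rewrite -[s]scale1r tlift_linear !scale1r. Qed.

Lemma tlift0 : tlift 0 = 0.
Proof. by have := tlift_linear (-1) 0 0; rewrite scaler0 addr0 scaleN1r addNr. Qed.
End Lift.

End TensorProduct.

Section BaseChange.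
Variables (F K : comNzRingType) (iota : {rmorphism F -> K}).

(* K as an F-module. *)
Definition restr (f : F -> K) : Type := K.
HB.instance Definition _ := GRing.ComNzRing.on (restr iota).

Definition rscale (a : F) (x : restr iota) : restr iota := iota a * (x : K).
Lemma rscalerA a b x : rscale a (rscale b x) = rscale (a * b) x.
Proof. by rewrite /rscale rmorphM mulrA. Qed.
Lemma rscale1r : left_id 1 rscale.
Proof. by move=> x; rewrite /rscale rmorph1 mul1r. Qed.
Lemma rscalerDr : right_distributive rscale +%R.
Proof. by move=> a x y; exact: mulrDr. Qed.
Lemma rscalerDl x : {morph rscale^~ x : a b / a + b}.
Proof. by move=> a b; rewrite /rscale rmorphD mulrDl. Qed.
HB.instance Definition _ := GRing.Zmodule_isLmodule.Build F (restr iota)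
  rscalerA rscale1r rscalerDr rscalerDl.

Variables (G : choiceType) (rel : freealg F G -> Prop).
Let A := presalg rel.
Let KA := tensor (restr iota) A.

(* The K-algebra obtained from the presented F-algebra A: K (x)_F A. *)
Definition bchange : Type := tensor (restr iota) (presalg rel).
HB.instance Definition _ := GRing.Zmodule.on bchange.

Definition btens (k : K) (x : A) : bchange := tens (k : restr iota) x.

Definition bscale : K -> bchange -> bchange := locked_with seal_key (fun c t =>
  tlift (fun (k : restr iota) (x : A) => btens (c * k) x : KA) t).
Canonical bscale_unlockable := [unlockable fun bscale].
Definition bone : bchange := btens 1 1.
Definition bmul : bchange -> bchange -> bchange := locked_with seal_key (fun s t =>
  tlift (fun (k : restr iota) (x : A) =>
    tlift (fun (l : restr iota) (y : A) => btens (k * l) (x * y) : KA) t : KA) s).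
Canonical bmul_unlockable := [unlockable fun bmul].

Lemma bilin_scale_l c (x : A) :
  linear ((fun (k : restr iota) (x : A) => btens (c * k) x : KA)^~ x).
Proof.
move=> a k k'; rewrite /btens -tens_linl; congr (tens _ _).
by rewrite mulrDr; congr (_ + _); exact: mulrCA.
Qed.
Lemma bilin_scale_r c (k : restr iota) :
  linear (fun (x : A) => btens (c * k) x : KA).
Proof. by move=> a x x'; rewrite /btens -tens_linr. Qed.

Lemma bscaleE c k x : bscale c (btens k x) = btens (c * k) x.
Proof. by rewrite [bscale]unlock; exact: (tliftE (bilin_scale_l c) (bilin_scale_r c)). Qed.

Lemma bscaleDr : right_distributive bscale +%R.
Proof.
by move=> c; rewrite [bscale]unlock; exact: (tliftD (bilin_scale_l c) (bilin_scale_r c)).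
Qed.

Lemma bscale0 c : bscale c 0 = 0.
Proof. by rewrite [bscale]unlock; exact: (tlift0 (bilin_scale_l c) (bilin_scale_r c)). Qed.

Lemma bchange_ind (P : bchange -> Prop) :
  P 0 -> (forall k x t, P t -> P (btens k x + t)) -> forall t, P t.
Proof. exact: (@tensor_ind F (restr iota) A P). Qed.

Lemma btensDl k l x : btens (k + l) x = btens k x + btens l x.
Proof. by have := tens_linl x 1 (k : restr iota) (l : restr iota); rewrite !scale1r. Qed.
Lemma btensDr k x y : btens k (x + y) = btens k x + btens k y.
Proof. by have := tens_linr (k : restr iota) 1 x y; rewrite !scale1r. Qed.
Lemma btensZr k a x : btens k (a *: x) = btens (iota a * k) x.
Proof. exact: etrans (tensZr _ _ _) (esym (tensZl a (k : restr iota) x)). Qed.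

Lemma bscaleA a b t : bscale a (bscale b t) = bscale (a * b) t.
Proof.
elim/bchange_ind: t => [|k x t IH]; first by rewrite !bscale0.
by rewrite !bscaleDr IH !bscaleE mulrA.
Qed.
Lemma bscale1r : left_id 1 bscale.
Proof.
elim/bchange_ind => [|k x t IH]; first by rewrite bscale0.
by rewrite !bscaleDr IH !bscaleE mul1r.
Qed.
Lemma bscaleDl t : {morph bscale^~ t : a b / a + b}.
Proof.
move=> a b; elim/bchange_ind: t => [|k x t IH]; first by rewrite !bscale0 addr0.
by rewrite !bscaleDr IH !bscaleE mulrDl btensDl addrACA.
Qed.

HB.instance Definition _ := GRing.Zmodule_isLmodule.Build K bchange
  bscaleA bscale1r bscaleDr bscaleDl.

Lemma bilin_mul_l k x (y : A) :
  linear ((fun (l : restr iota) (y : A) => btens (k * l) (x * y) : KA)^~ y).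
Proof. by move=> a l l'; exact: bilin_scale_l. Qed.
Lemma bilin_mul_r (k : K) (x : A) (l : restr iota) :
  linear (fun (y : A) => btens (k * l) (x * y) : KA).
Proof. by move=> a y y'; rewrite /btens mulrDr -pres_scalerAr -tens_linr. Qed.

Let inner t (k : restr iota) (x : A) : KA :=
  tlift (fun (l : restr iota) (y : A) => btens (k * l) (x * y) : KA) t.

Let innerE k x l y : inner (btens l y) k x = btens (k * l) (x * y).
Proof. exact: (tliftE (bilin_mul_l k x) (bilin_mul_r k x)). Qed.
Let innerD s t k x : inner (s + t) k x = inner s k x + inner t k x.
Proof. exact: (tliftD (bilin_mul_l k x) (bilin_mul_r k x)). Qed.
Let inner0 k x : inner 0 k x = 0.
Proof. exact: (tlift0 (bilin_mul_l k x) (bilin_mul_r k x)). Qed.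

Let inner_l t x : linear ((inner t)^~ x).
Proof.
move=> a k k'; elim/bchange_ind: t => [|l y t IH].
  by rewrite !inner0 scaler0 addr0.
rewrite !innerD IH !innerE scalerDr addrACA; congr (_ + _).
rewrite /btens -tens_linl; congr (tens _ _).
by rewrite mulrDl; congr (_ + _); exact: esym (mulrA _ _ _).
Qed.
Let inner_r t k : linear (inner t k).
Proof.
move=> a x x'; elim/bchange_ind: t => [|l y t IH].
  by rewrite !inner0 scaler0 addr0.
rewrite !innerD IH !innerE scalerDr addrACA; congr (_ + _).
by rewrite /btens mulrDl -pres_scalerAl -tens_linr.
Qed.

Let bmul_btens k x t : bmul (btens k x) t = inner t k x.
Proof. by rewrite [bmul]unlock; exact: (tliftE (inner_l t) (inner_r t)). Qed.

Lemma bmulE k x l y : bmul (btens k x) (btens l y) = btens (k * l) (x * y).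
Proof. by rewrite bmul_btens innerE. Qed.
Lemma bmulDl : left_distributive bmul +%R.
Proof.
by move=> r s t; rewrite [bmul]unlock; exact: (tliftD (inner_l t) (inner_r t)).
Qed.
Lemma bmul0l t : bmul 0 t = 0.
Proof. by rewrite [bmul]unlock; exact: (tlift0 (inner_l t) (inner_r t)). Qed.
Lemma bmul0r t : bmul t 0 = 0.
Proof.
elim/bchange_ind: t => [|k x t IH]; first exact: bmul0l.
by rewrite bmulDl IH addr0 bmul_btens inner0.
Qed.
Lemma bmulDr : right_distributive bmul +%R.
Proof.
move=> r s t; elim/bchange_ind: r => [|k x r IH]; first by rewrite !bmul0l addr0.
by rewrite !bmulDl IH addrACA; congr (_ + _); rewrite !bmul_btens innerD.
Qed.

Lemma bmulA : associative bmul.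
Proof.
move=> r; elim/bchange_ind: r => [|k x r IH] s t; first by rewrite !bmul0l.
rewrite !bmulDl IH; congr (_ + _) => {IH}.
elim/bchange_ind: s => [|l y s IHs]; first by rewrite !(bmul0l, bmul0r).
rewrite !(bmulDl, bmulDr) IHs; congr (_ + _) => {s IHs}.
elim/bchange_ind: t => [|m z t IHt]; first by rewrite !bmul0r.
by rewrite !bmulDr IHt !bmulE !mulrA.
Qed.
Lemma bmul1r : left_id bone bmul.
Proof.
elim/bchange_ind => [|k x t IH]; first by rewrite bmul0r.
by rewrite bmulDr IH bmulE !mul1r.
Qed.
Lemma bmulr1 : right_id bone bmul.
Proof.
elim/bchange_ind => [|k x t IH]; first by rewrite bmul0l.
by rewrite bmulDl IH bmulE !mulr1.
Qed.

HB.instance Definition _ := GRing.Zmodule_isPzRing.Build bchange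
  bmulA bmul1r bmulr1 bmulDl bmulDr.

Lemma bchange_scalerAl (a : K) (s t : bchange) : a *: (s * t) = (a *: s) * t.
Proof.
elim/bchange_ind: s => [|k x s IHs]; first by rewrite !(mul0r, scaler0).
rewrite !(mulrDl, scalerDr) IHs; congr (_ + _) => {s IHs}.
elim/bchange_ind: t => [|l y t IHt]; first by rewrite !(mulr0, scaler0).
rewrite !(mulrDr, scalerDr) IHt; congr (_ + _).
by rewrite -[btens k x * _]/(bmul _ _) bmulE -[LHS]/(bscale _ _) bscaleE
  -[RHS]/(bmul (bscale _ _) _) bscaleE bmulE mulrA.
Qed.
Lemma bchange_scalerAr (a : K) (s t : bchange) : a *: (s * t) = s * (a *: t).
Proof.
elim/bchange_ind: s => [|k x s IHs]; first by rewrite !(mul0r, scaler0).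
rewrite !(mulrDl, scalerDr) IHs; congr (_ + _) => {s IHs}.
elim/bchange_ind: t => [|l y t IHt]; first by rewrite !(mulr0, scaler0).
rewrite !(mulrDr, scalerDr) IHt; congr (_ + _).
by rewrite -[btens k x * _]/(bmul _ _) bmulE -[LHS]/(bscale _ _) bscaleE
  -[RHS]/(bmul _ (bscale _ _)) bscaleE bmulE mulrCA.
Qed.
End BaseChange.

Section IteratedTensor.
Variables (R : comNzRingType) (V : int -> lmodType R).

(* [tchain n b] is V b (x) (V (b-1) (x) (... (x) V (b-n))). *)
Fixpoint tchain (n : nat) (b : int) : lmodType R :=
  if n is n'.+1 then tensor (V b) (tchain n' (b - 1)) else V b.

Fixpoint tpure (x : forall k, V k) (n : nat) (b : int) : tchain n b :=
  if n is n'.+1 return tchain n b then tens (x b) (tpure x n' (b - 1)) else x b.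
End IteratedTensor.

(* Q(q) and Q(q^{1/2}) are both fields of fractions of a polynomial ring in one
   variable over Q; the variable is q in the former and q^{1/2} in the latter,
   so that the inclusion substitutes 'X ^+ 2 for 'X. *)
Definition Qq : fieldType := {fraction {poly rat}}.
Definition Qqhalf : fieldType := {fraction {poly rat}}.

Definition q_Qq : Qq := FracField.tofrac 'X.
Definition qhalf : Qqhalf := FracField.tofrac 'X.

Definition subst_sq (p : {poly rat}) : Qqhalf := FracField.tofrac (p \Po 'X^2).
Definition qincl (x : Qq) : Qqhalf :=
  let r := frac (repr (x : {fraction {poly rat}})) in subst_sq r.1 / subst_sq r.2.

Lemma subst_sq_is_zmod_morphism : zmod_morphism subst_sq.
Proof. by move=> p p'; rewrite /subst_sq rmorphB rmorphB. Qed.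
Lemma subst_sq_is_monoid_morphism : monoid_morphism subst_sq.
Proof. by split=> [|p p']; rewrite /subst_sq ?rmorph1 // rmorphM rmorphM. Qed.
HB.instance Definition _ :=
  GRing.isZmodMorphism.Build {poly rat} Qqhalf subst_sq subst_sq_is_zmod_morphism.
HB.instance Definition _ := GRing.isMonoidMorphism.Build {poly rat} Qqhalf
  subst_sq subst_sq_is_monoid_morphism.

Lemma subst_sq_eq0 p : (subst_sq p == 0) = (p == 0).
Proof. by rewrite tofrac_eq0 comp_poly_eq0 // size_polyXn. Qed.

Lemma Qq_repr (x : Qq) :
  let r := frac (repr (x : {fraction {poly rat}})) in
  x = FracField.tofrac r.1 / FracField.tofrac r.2.
Proof.
rewrite /= -{1}[x]reprK; set r := repr _.
apply/esym; rewrite -{3}[r]Ratio_numden; unlock FracField.tofrac.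
rewrite -[(\pi_{fraction {poly rat}} _)^-1]FracField.pi_inv.
rewrite -[LHS]FracField.pi_mul /FracField.mulf /FracField.invf.
by rewrite /= !numden_Ratio ?oner_neq0 ?denom_ratioP // mul1r mulr1.
Qed.

Lemma qincl_frac n d : d != 0 ->
  qincl (FracField.tofrac n / FracField.tofrac d) = subst_sq n / subst_sq d.
Proof.
move=> d0; set x := (X in qincl X); have := Qq_repr x.
rewrite /qincl; move: (denom_ratioP (repr (x : {fraction {poly rat}}))).
case: (frac _) => n' d' /= d'0 /eqP.
rewrite eqr_div ?tofrac_eq0 // -!tofracM tofrac_eq => /eqP E.
by apply/eqP; rewrite eqr_div ?subst_sq_eq0 // -!rmorphM -E.
Qed.

Lemma Qq_fracP (x : Qq) : exists n d : {poly rat}, d != 0 /\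
  x = FracField.tofrac n / FracField.tofrac d.
Proof. by do 2!eexists; split; [|exact: Qq_repr]; exact: denom_ratioP. Qed.

Lemma qincl_is_zmod_morphism : zmod_morphism qincl.
Proof.
move=> x y; have [n [d [d0 ->]]] := Qq_fracP x; have [m [e [e0 ->]]] := Qq_fracP y.
rewrite -mulNr -tofracN addf_div ?tofrac_eq0 // -!tofracM -tofracD.
rewrite !qincl_frac ?mulf_neq0 // -mulNr -rmorphN addf_div ?subst_sq_eq0 //.
by rewrite -!rmorphM -rmorphD.
Qed.
Lemma qincl_is_monoid_morphism : monoid_morphism qincl.
Proof.
split=> [|x y].
  by rewrite -[1](divr1 1) -tofrac1 qincl_frac ?oner_neq0 // rmorph1 divr1.
have [n [d [d0 ->]]] := Qq_fracP x; have [m [e [e0 ->]]] := Qq_fracP y.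
rewrite mulf_div -!tofracM !qincl_frac ?mulf_neq0 //.
by rewrite mulf_div -!rmorphM.
Qed.
HB.instance Definition _ :=
  GRing.isZmodMorphism.Build Qq Qqhalf qincl qincl_is_zmod_morphism.
HB.instance Definition _ :=
  GRing.isMonoidMorphism.Build Qq Qqhalf qincl qincl_is_monoid_morphism.

Lemma qincl_q : qincl q_Qq = qhalf ^+ 2.
Proof.
rewrite -[q_Qq]divr1 -{1}tofrac1 qincl_frac ?oner_neq0 // rmorph1 divr1.
by rewrite /subst_sq comp_polyX tofracXn.
Qed.

Record symmetrizable_GCM (I : Type) (C : I -> I -> int) : Prop := {
  gcm_diag : forall i, C i i = 2;
  gcm_offdiag : forall i j, i <> j -> C i j <= 0;
  gcm_zero : forall i j, C i j = 0 -> C j i = 0;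
  gcm_sym : exists d : I -> int, (forall i, 0 < d i) /\
    (forall i j, d i * C i j = d j * C j i)
}.

(* The root data are a symmetrizable generalized Cartan matrix [cmat] together with
   the weight lattice [wlat], a free abelian group, the simple roots and coroots, and
   the Q-valued form on the weight lattice. *)
Record root_data (I : choiceType) := RootData {
  cmat : I -> I -> int;
  cmat_gcm : symmetrizable_GCM cmat;
  wlat : zmodType;
  wlat_free : exists (B : choiceType) (e : {additive {malg int[B]} -> wlat}),
    bijective e;
  sroot : I -> wlat;
  coroot : I -> {additive wlat -> int};
  coroot_sroot : forall i j, coroot i (sroot j) = cmat i j;
  wform : wlat -> wlat -> rat;
  wformC : forall x y, wform x y = wform y x;
  wformDl : forall x y z, wform (x + y) z = wform x z + wform y z;
  wform_even : forall i, exists n : nat,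
    (0 < n)%N /\ wform (sroot i) (sroot i) = (2 * n)%:R;
  coroot_wform : forall i x, (coroot i x)%:~R =
    2 * wform (sroot i) x / wform (sroot i) (sroot i)
}.

Section Quantum.
Variables (I : choiceType) (D : root_data I).

(* The exponents (alpha_i, alpha_i) / 2 and (alpha_i, alpha_j) of q are integers;
   [Num.floor] only changes their type. *)
Definition qexp (i : I) : int := Num.floor (wform (sroot D i) (sroot D i) / 2).
Definition rform (i j : I) : int := Num.floor (wform (sroot D i) (sroot D j)).

Lemma qexpE i : (qexp i)%:~R = wform (sroot D i) (sroot D i) / 2.
Proof.
rewrite /qexp; have [n [_ ->]] := wform_even D i.
by rewrite natrM mulrAC divff // mul1r -[n%:R]/((n : int)%:~R) intrKfloor.
Qed.

Lemma rformE i j : (rform i j)%:~R = wform (sroot D i) (sroot D j).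
Proof.
rewrite /rform; have [n [n0 E]] := wform_even D i; have := coroot_wform i (sroot D j).
have nz k : (0 < k)%N -> k%:R != 0 :> rat by rewrite pnatr_eq0 lt0n.
rewrite E natrM -mulf_div divff ?nz // mul1r.
move/(canLR (mulfVK (nz _ n0))) => H.
have -> : wform (sroot D i) (sroot D j)
    = (coroot D i (sroot D j) * (n : int))%:~R by rewrite intrM H.
by rewrite intrKfloor.
Qed.

Section Coefficients.
Variables (E : fieldType) (q : E).

Definition qi (i : I) : E := q ^ qexp i.
Definition qint (i : I) (n : nat) : E :=
  (qi i ^+ n - qi i ^- n) / (qi i - (qi i)^-1).
Definition qfact (i : I) (n : nat) : E := \prod_(1 <= k < n.+1) qint i k.
Definition qbinom (i : I) (m n : nat) : E :=
  qfact i m / (qfact i n * qfact i (m - n)).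

Definition serre (G : choiceType) (f : I -> freealg E G) (i j : I) : freealg E G :=
  let m := absz (1 - coroot D i (sroot D j)) in
  \sum_(k < m.+1) ((-1) ^+ k * qbinom i m k) *: (f i ^+ k * f j * f i ^+ (m - k)).
End Coefficients.

Variant Uminus_rel : freealg Qq I -> Prop :=
| Uminus_serre i j : i != j -> Uminus_rel (serre q_Qq (freegen Qq) i j).

Definition Uminus := presalg Uminus_rel.
(* Q(q^{1/2}) (x)_{Q(q)} Uminus, with generators 1 (x) f_i. *)
Definition Uhalf := bchange qincl Uminus_rel.
Definition Ugen (i : I) : Uhalf := btens qincl 1 (presgen Uminus_rel i).

Definition q_Qqhalf : Qqhalf := qhalf ^+ 2.

Definition fgen (i : I) (p : int) : freealg Qqhalf (I * int)%type :=
  freegen Qqhalf (i, p).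

Variant Ahat_rel : freealg Qqhalf (I * int)%type -> Prop :=
| Ahat_serre i j p : i != j -> Ahat_rel (serre q_Qqhalf (fgen^~ p) i j)
| Ahat_boson i j m p : m < p ->
    Ahat_rel (fgen i m * fgen j p
      - (q_Qqhalf ^ ((-1) ^ (p - m + 1) * rform i j) *: (fgen j p * fgen i m)
         + (((j, p) == (i, m + 1))%:R * (1 - qi q_Qqhalf i ^+ 2))%:A)).

Definition Ahat := presalg Ahat_rel.
Definition Agen (i : I) (p : int) : Ahat := presgen Ahat_rel (i, p).

Definition Ahat_int (a b : int) :=
  subalg (fun x : Ahat => exists i k, [/\ a <= k, k <= b & x = Agen i k]).
End Quantum.

(* Main.v *)
From HB Require Import structures.
From mathcomp Require Import all_boot all_order all_algebra.
From mathcomp Require Import finmap ring zify.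
Require Import Defs.

(** Both parts say that no relation among the generators f_(i,p) is lost or
    gained when words are brought into normal form, so that the algebra is, as a
    vector space, the tensor product of one copy of U^- for each level p.

    Call a word in the f_(i,p) ordered when its levels weakly decrease. The
    commutation relations rewrite f_(i,m) f_(j,p) when m < p, so the ordered words
    with levels in [a, b] span the subalgebra of [a, b]; this gives surjectivity.
    For injectivity one needs linear maps out of the algebra.

    First forget the Serre relations. Inserting a letter into an ordered word by
    means of the commutation relations makes the span of the ordered words a module
    on which these relations hold [act_comm]; the only thing to check is that
    moving two letters past a third one gives the same result in both orders, and
    this holds because the exponents of q change sign with each step in the level.
    Acting on the empty word gives the normal form of any element, and ordered
    words are their own normal forms [nact_ordered1].

    Now take the Serre relations into account. The Serre element of level p
    commutes up to a nonzero scalar with every generator of another level, modulo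
    the commutation relations alone [serre_skew_comm]. A generator f_(k,r) of an
    adjacent level acts on the elements of level p as a twisted derivation, and the
    Serre element is killed by it: for k = j this is an alternating sum of
    q-binomials that vanishes, and for k = i the terms cancel in pairs. As a
    consequence the normal forms of the elements of the ideal are combinations of
    ordered words with a Serre element inserted at its proper place
    [tact_serre_in_span]. This yields an extension principle [Ahat_linear_ext]: a
    function on ordered words that kills the Serre elements, one level at a time,
    extends linearly to the algebra.

    Applied to the function that sends an ordered word to the pure tensor of its
    level components, the principle gives a left inverse of the multiplication map
    [chain_section]. Applied to the function that sends a word of level m to the
    same word in U^-, and a word with another level to 0, it gives a left inverse of
    the morphism L_m [level_section]. *)

Set Implicit Arguments.
Unset Strict Implicit.
Unset Printing Implicit Defensive.

Import Order.TTheory GRing.Theory Num.Theory.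
Local Open Scope ring_scope.

(** * Words as a basis of the free algebra *)
Section Words.
Variables (R : comNzRingType) (G : choiceType).
Notation T := (freealg R G).

Definition word (w : seq G) : T := << FMonom w >>.

Lemma word_nil : word [::] = 1.
Proof. by rewrite /word -fmoneE. Qed.

Lemma word1 g : word [:: g] = freegen R g.
Proof. by rewrite /word /freegen fmuE. Qed.

Lemma word_cat u v : word (u ++ v) = word u * word v.
Proof.
rewrite [RHS]freealg_mulE /word [RHS]malgM_def.
by rewrite fgmulUU mulr1; congr (<< _ >>); exact/esym/fmmulE.
Qed.

Lemma word_cons g w : word (g :: w) = freegen R g * word w.
Proof. by rewrite -cat1s word_cat word1. Qed.

Lemma word_nseq k g : word (nseq k g) = freegen R g ^+ k.
Proof. by elim: k => [|k IH] /=; rewrite ?word_nil // word_cons IH exprS. Qed.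

Lemma word_ind (P : T -> Prop) :
  P 0 -> (forall c w x, P x -> P (c *: word w + x)) -> forall x, P x.
Proof.
move=> P0 PS x.
have -> : x = \sum_(k <- msupp x) x@_k *: word k :> T.
  rewrite {1}[x]monalgE; apply: eq_bigr => k _.
  rewrite [RHS]freealg_scaleE /word; apply/malgP => l.
  by rewrite mcoeffZ !mcoeffU fmK mulr_natr.
by elim/big_rec: _ => // k y _; apply: PS.
Qed.

Section Extension.
Variables (M : lmodType R) (phi : seq G -> M).

Definition wext (x : T) : M := \sum_(k <- msupp x) x@_k *: phi k.

Lemma wextEw (d : {fset {fmonom G}}) (x : T) : (msupp x `<=` d)%fset ->
  wext x = \sum_(k <- d) x@_k *: phi k.
Proof.
move=> le; rewrite [LHS](big_fset_incl _ le) => //= k kd /mcoeff_outdom ->.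
by rewrite scale0r.
Qed.

Lemma wext_linear : linear wext.
Proof.
move=> a x y; pose d := (msupp x `|` msupp y)%fset.
rewrite !(@wextEw d) ?fsubsetUl ?fsubsetUr //; last first.
  apply: fsubset_trans (msuppD_le _ _) _; apply: fsetSU.
  by rewrite freealg_scaleE; exact: msuppZ_le.
rewrite scaler_sumr -big_split /=; apply: eq_bigr => k _.
by rewrite mcoeffD freealg_scaleE mcoeffZ scalerDl scalerA.
Qed.
HB.instance Definition _ := GRing.isLinear.Build R T M *:%R wext wext_linear.

Lemma wext_word w : wext (word w) = phi w.
Proof.
rewrite (@wextEw [fset FMonom w]%fset) ?msuppU_le //.
by rewrite big_seq_fset1 mcoeffUU scale1r.
Qed.
End Extension.

End Words.
Arguments word R {G} w.

(** * Straightening words with the commutation relations *)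
Lemma span_sub (R : nzRingType) (V : lmodType R) (S S' : V -> Prop) :
  (forall x, S x -> S' x) -> forall x, span S x -> span S' x.
Proof.
move=> SS x; elim=> [|a u v Su _ IH]; first exact: span0.
by apply: span_cons => //; apply: SS.
Qed.

Lemma span_linear (R : nzRingType) (V W : lmodType R) (f : {linear V -> W})
  (S : V -> Prop) (S' : W -> Prop) :
  (forall x, S x -> span S' (f x)) -> forall x, span S x -> span S' (f x).
Proof.
move=> SS x; elim=> [|a u v Su _ IH]; first by rewrite linear0; exact: span0.
by rewrite linearP; apply: spanD IH; apply: spanZ; apply: SS.
Qed.

Lemma span_linear_eq (R : nzRingType) (V W : lmodType R) (f g : {linear V -> W})
  (S : V -> Prop) :
  (forall x, S x -> f x = g x) -> forall x, span S x -> f x = g x.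
Proof.
move=> fg x; elim=> [|a u v Su _ IH]; first by rewrite !linear0.
by rewrite !linearP /= IH fg.
Qed.

(** Generators carry a level, and a generator [g] of lower level moves past a
    generator [h] of higher level by g h = s g h *: h g + d g h. *)
Section Straightening.
Variables (R : comNzRingType) (G : choiceType) (lev : G -> int).
Variables (s d : G -> G -> R).
Notation T := (freealg R G).
Notation fr := (freegen R).

(* These hypotheses make the rewriting confluent on g f h with levels
   lev g < lev f < lev h. Carrying the constant term of one pair through the third
   letter must cost the same scalar as carrying the pair itself: s_inv1 concerns
   the pair (f, h) and the letter g, and s_inv2 the pair (g, f) and the letter h.
   By d_adj the pair (g, h) has no constant term, its levels being too far apart. *)
Hypothesis d_adj : forall g h, lev h != lev g + 1 -> d g h = 0.
Hypothesis s_inv1 : forall g f h, lev g < lev f -> lev f < lev h ->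
  s g f * s g h * d f h = d f h.
Hypothesis s_inv2 : forall g f h, lev g < lev f -> lev f < lev h ->
  s f h * s g h * d g f = d g f.

(** The product g w with [g] moved to the right until the next letter is of no
    higher level, together with the constant terms left on the way. *)
Fixpoint ins (g : G) (w : seq G) : T :=
  if w is h :: v then
    if lev h <= lev g then word R (g :: w)
    else s g h *: (fr h * ins g v) + d g h *: word R v
  else word R [:: g].

Definition act (g : G) : T -> T := wext (ins g).
HB.instance Definition _ g := GRing.Linear.on (act g).

Lemma act_word g w : act g (word R w) = ins g w.
Proof. exact: wext_word. Qed.

Lemma act_pass g h x : lev g < lev h ->
  act g (fr h * x) = s g h *: (fr h * act g x) + d g h *: x.
Proof.
move=> gh; elim/word_ind: x => [|c w x IH].
  by rewrite mulr0 !linear0 mulr0 scaler0 addr0.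
rewrite mulrDr -scalerAr !linearP /= IH -word_cons.
rewrite !act_word /=.
rewrite leNgt gh /= mulrDr !scalerDr -scalerAr !scalerA.
rewrite -!addrA; congr (_ + _); first by congr (_ *: _); exact: mulrC.
by rewrite addrCA [c * d g h]mulrC.
Qed.

Definition upto (Q : pred int) (p : int) : pred int :=
  fun k => Q k && (k <= p).

Definition ordered (w : seq G) := sorted (fun g h => lev h <= lev g) w.
Arguments ordered w : simpl never.

(** The set [Q] restricts the levels. Inductions on a word remove its first letter
    [h], after which all levels are at most that of [h]; keeping track of this is
    what allows [h] to be put back in front. *)
Definition ospan (Q : pred int) : T -> Prop :=
  span (fun x => exists2 w, ordered w && all (Q \o lev) w & x = word R w).

Lemma all_upto (Q : pred int) p w :
  all (upto Q p \o lev) w = all (Q \o lev) w && all (fun g => lev g <= p) w.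
Proof. exact: all_predI. Qed.

Lemma ordered_cons g w :
  ordered (g :: w) = all (fun h => lev h <= lev g) w && ordered w.
Proof.
by rewrite /ordered /= path_sortedE // => x y z /= h1 h2; exact: le_trans h2 h1.
Qed.

Lemma ordered_cat u w p :
  ordered u -> ordered w -> all (fun g => p <= lev g) u ->
  all (fun g => lev g <= p) w -> ordered (u ++ w).
Proof.
move=> + ow; elim: u => [|g u IH] //=; rewrite !ordered_cons all_cat.
move=> /andP[-> ou] /andP[pg pu] pw /=; rewrite IH // andbT.
by apply: sub_all pw => h /= /le_trans; apply.
Qed.

Lemma ospan_word (Q : pred int) w :
  ordered w -> all (Q \o lev) w -> ospan Q (word R w).
Proof. by move=> ow Qw; apply: span_incl; exists w; rewrite ?ow. Qed.

Lemma ospan1 (Q : pred int) : ospan Q 1.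
Proof. by rewrite -word_nil; apply: ospan_word. Qed.

Lemma ospanS (Q Q' : pred int) : subpred Q Q' -> forall x, ospan Q x -> ospan Q' x.
Proof.
move=> QQ; apply: span_sub => _ [w /andP[ow Qw] ->]; exists w => //.
by rewrite ow /=; apply: sub_all Qw => g; apply: QQ.
Qed.

Lemma ospan_cons (Q : pred int) g x : Q (lev g) ->
  ospan (upto Q (lev g)) x -> ospan Q (fr g * x).
Proof.
move=> Qg; elim=> [|a _ v [w /andP[ow Qw] ->] _ IH].
  by rewrite mulr0; exact: span0.
rewrite mulrDr -scalerAr -word_cons; apply: spanD IH; apply: spanZ.
apply: ospan_word; rewrite ?ordered_cons /= ?Qg /=.
  by rewrite ow andbT; apply: sub_all Qw => h /andP[].
by apply: sub_all Qw => h /andP[].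
Qed.

(** [g] moves past higher letters only, and these may be put back in front of
    whatever is inserted after them. *)
Lemma ins_ospan (Q : pred int) g w :
  ordered w -> all (Q \o lev) w -> Q (lev g) -> ospan Q (ins g w).
Proof.
elim: w Q => [|h w IH] Q ow Qw Qg /=.
  by apply: ospan_word => //=; rewrite Qg.
case: leP => hg.
  apply: ospan_word; last by rewrite /= Qg.
  rewrite ordered_cons ow andbT /= hg /=.
  move: ow; rewrite ordered_cons => /andP[ow _].
  by apply: sub_all ow => k /= /le_trans; apply.
move: ow Qw; rewrite ordered_cons /= => /andP[hw ow] /andP[Qh Qw].
apply: spanD; apply: spanZ; last exact: ospan_word.
apply: ospan_cons => //; apply: IH => //; last by rewrite /upto Qg ltW.
by rewrite all_upto Qw.
Qed.

Lemma act_ospan (Q : pred int) g : Q (lev g) ->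
  forall x, ospan Q x -> ospan Q (act g x).
Proof.
move=> Qg; apply: span_linear => _ [w /andP[ow Qw] ->].
by rewrite /= act_word; apply: ins_ospan.
Qed.

(** Nothing needs to be moved when [g] is of maximal level. *)
Lemma act_top g x : ospan (fun k => k <= lev g) x -> act g x = fr g * x.
Proof.
elim=> [|a _ v [w /andP[ow Qw] ->] _ IH]; first by rewrite linear0 mulr0.
rewrite linearP /= IH mulrDr -scalerAr act_word -word_cons; congr (_ *: _ + _).
by case: w ow Qw => //= h w _ /andP[-> _].
Qed.

(** The confluence check, by induction on the word. If the first letter [h] is of
    no higher level than [f], then [f] is put in front of everything and the
    identity is [act_pass]. Otherwise both [f] and [g] pass [h], and the constant
    terms match by [s_inv1] and [s_inv2]. *)
Lemma act_word_comm g f w : lev g < lev f -> ordered w ->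
  act g (act f (word R w)) =
    s g f *: act f (act g (word R w)) + d g f *: word R w.
Proof.
move=> gf; elim: w => [|h w IH] ow.
  by rewrite !act_word /= leNgt gf (ltW gf) !word_cons word_nil mulr1.
case: (leP (lev h) (lev f)) => hf.
  have owf : ospan (fun k => k <= lev f) (word R (h :: w)).
    apply: ospan_word => //; rewrite /= hf /=.
    move: ow; rewrite ordered_cons => /andP[ow _].
    by apply: sub_all ow => k /= /le_trans; apply.
  rewrite (act_top owf) act_pass // [act f _]act_top //.
  by apply: act_ospan => //; rewrite ltW.
have gh : lev g < lev h by exact: lt_trans hf.
have dgh : d g h = 0.
  apply: d_adj; apply/negP => /eqP E.
  by move: hf; rewrite E ltzD1 leNgt gf.
move: ow; rewrite ordered_cons => /andP[_ ow]; rewrite word_cons.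
rewrite !act_pass // dgh scale0r addr0 linearP !linearZ /= !act_pass //.
rewrite dgh scale0r addr0 IH // mulrDr !scalerDr -!scalerAr !scalerA -!addrA.
congr (_ + _); first by congr (_ *: _); ring.
by rewrite s_inv2 // [s g h * _]mulrC s_inv1 // addrC.
Qed.

Lemma act_comm (Q : pred int) g f x : lev g < lev f -> ospan Q x ->
  act g (act f x) = s g f *: act f (act g x) + d g f *: x.
Proof.
move=> gf; elim=> [|a _ v [w /andP[ow _] ->] _ IH].
  by rewrite !linear0 ?scaler0 addr0.
rewrite !linearP /= IH act_word_comm // !scalerDr !scalerA addrACA.
by congr (_ *: _ + _ *: _ + _); exact: mulrC.
Qed.

Definition nact (w : seq G) (v : T) : T := foldr act v w.

Lemma nact_linear w : linear (nact w).
Proof. by elim: w => [|g w IH] a u v //=; rewrite IH linearP. Qed.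
HB.instance Definition _ w :=
  GRing.isLinear.Build R T T *:%R (nact w) (nact_linear w).

(** The free algebra acting through [act]. The vector comes first, as the map is
    mostly used as a function of the acting element. *)
Definition tact (v : T) : T -> T := wext (nact^~ v).
HB.instance Definition _ v := GRing.Linear.on (tact v).

Lemma tact_word v w : tact v (word R w) = nact w v.
Proof. exact: wext_word. Qed.

Lemma tact1 v : tact v 1 = v.
Proof. by rewrite -word_nil tact_word. Qed.

Lemma tact_gen v g : tact v (fr g) = act g v.
Proof. by rewrite -word1 tact_word. Qed.

Lemma tactl_linear x : linear (tact^~ x).
Proof.
move=> a u v; elim/word_ind: x => [|c w x IH].
  by rewrite !linear0 ?scaler0 addr0.
rewrite !linearP /= IH !tact_word nact_linear !scalerDr addrACA !scalerA.
by congr (_ *: _ + _ + _); exact: mulrC.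
Qed.

Lemma tact0 x : tact 0 x = 0.
Proof.
by have := tactl_linear x (-1) 0 0; rewrite scaler0 addr0 scaleN1r addNr.
Qed.

Lemma tactM v x y : tact v (x * y) = tact (tact v y) x.
Proof.
elim/word_ind: x => [|c w x IH]; first by rewrite mul0r !linear0.
rewrite mulrDl -scalerAl !linearP /= IH; congr (_ *: _ + _).
rewrite tact_word => {IH}; elim/word_ind: y => [|c' w' y IHy].
  by rewrite mulr0 !linear0 /= ?tact0.
rewrite mulrDr -scalerAr !linearP /= IHy; congr (_ *: _ + _).
by rewrite -word_cat !tact_word /nact foldr_cat.
Qed.

Lemma tact_ospan (Q : pred int) v x : ospan Q v ->
  (forall g, Q (lev g)) -> ospan Q (tact v x).
Proof.
move=> ov Qg; elim/word_ind: x => [|c w x IH].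
  by rewrite linear0; exact: span0.
rewrite linearP /= tact_word; apply: spanD IH; apply: spanZ.
by elim: w => //= g w IH; apply: act_ospan.
Qed.

Lemma nact_ospan (Q : pred int) v w : ospan Q v -> all (Q \o lev) w ->
  ospan Q (nact w v).
Proof. by move=> ov; elim: w => //= g w IH /andP[Qg /IH]; exact: act_ospan. Qed.

Lemma nact_ordered p w v : ordered w -> all (fun g => p <= lev g) w ->
  ospan (fun k => k <= p) v -> nact w v = word R w * v.
Proof.
move=> + + ov; elim: w => [|g w IH] /=; first by rewrite word_nil mul1r.
rewrite ordered_cons => /andP[gw ow] /andP[pg pw].
rewrite IH // act_top ?word_cons ?mulrA // -IH //.
apply: nact_ospan => //.
by apply: ospanS ov => k /= /le_trans; apply.
Qed.

(** This is what makes the ordered words linearly independent modulo the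
    commutation relations. *)
Lemma nact_ordered1 w : ordered w -> nact w 1 = word R w.
Proof.
elim: w => [|g w IH] /=; first by rewrite word_nil.
rewrite ordered_cons => /andP[gw ow]; rewrite IH // act_top ?word_cons //.
exact: ospan_word.
Qed.

Variant boson_rel : T -> Prop :=
  Boson g f : lev g < lev f ->
    boson_rel (fr g * fr f - (s g f *: (fr f * fr g) + (d g f)%:A)).

Section Quotient.
Variable rel : T -> Prop.
Hypothesis boson_sub : forall x, boson_rel x -> rel x.
Notation pr := (presproj rel).

Lemma presproj_boson g f : lev g < lev f ->
  pr (fr g) * pr (fr f) =
    s g f *: (pr (fr f) * pr (fr g)) + d g f *: (1 : presalg rel).
Proof.
move=> gf; have := presproj_rel (boson_sub (Boson gf)).
rewrite linearB linearD !linearZ !rmorphM rmorph1 /= => /eqP.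
by rewrite subr_eq0 => /eqP.
Qed.

(** Straightening does not change the class of an element modulo the commutation
    relations. *)
Lemma presproj_act g x : pr (act g x) = pr (fr g) * pr x.
Proof.
elim/word_ind: x => [|c w x IH]; first by rewrite !linear0 mulr0.
rewrite !linearP /= IH mulrDr -pres_scalerAr; congr (_ *: _ + _) => {x c IH}.
rewrite act_word -rmorphM -word_cons; elim: w => //= h w IH.
case: leP => // gh; rewrite linearD !linearZ rmorphM /= IH !word_cons.
rewrite !rmorphM /= !mulrA (presproj_boson gh) mulrDl -!pres_scalerAl.
by rewrite mul1r.
Qed.
End Quotient.

Definition any_level : pred int := fun=> true.

(** Only the action on ordered words satisfies the commutation relations, so [v]
    must be in their span. *)
Lemma tact_boson v x : ospan any_level v -> span (ideal_gen boson_rel) x ->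
  tact v x = 0.
Proof.
move=> ov; elim=> [|c _ y [a [_ [b [[g f gf] ->]]]] _ IH].
  by rewrite linear0.
rewrite linearP /= IH addr0 !tactM; have := tact_ospan b ov (fun=> isT).
move: (tact v b) => u ou.
rewrite linearB linearD !linearZ /= !tactM !tact_gen tact1 (act_comm gf ou).
by rewrite subrr tact0 scaler0.
Qed.

End Straightening.
Arguments ordered {G} lev w : simpl never.

(** * Identities between q-binomials *)
Section QBinomials.
Variable E : fieldType.

Definition qnum (w : E) n := (w ^+ n - w ^- n) / (w - w^-1).
Definition qfac w n := \prod_(1 <= k < n.+1) qnum w k.
Definition qbin w m n := qfac w m / (qfac w n * qfac w (m - n)).

(** Moving a generator past a Serre element leads to identities with w = q_i or
    w = q_i^-1, according to its colour and to whether its level is lower or higher;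
    the binomials are those of the Serre element in both cases. *)
Lemma qnumV w n : qnum w^-1 n = qnum w n.
Proof.
by rewrite /qnum invrK exprVn invrK -opprB -[w^-1 - w]opprB invrN mulrNN.
Qed.

Lemma qbinV w m n : qbin w^-1 m n = qbin w m n.
Proof. by rewrite /qbin /qfac; congr (_ / (_ * _)); apply: eq_bigr => k _; apply: qnumV. Qed.

Variable w : E.
Hypothesis w0 : w != 0.
Hypothesis w_gen : forall n, (0 < n)%N -> w ^+ n != 1.

Lemma qnum_neq0 n : (0 < n)%N -> qnum w n != 0.
Proof.
have sub_inv k : (0 < k)%N -> w ^+ k - w ^- k != 0.
  move=> k0; rewrite subr_eq0; apply: contra (w_gen (n := k + k) _) => [/eqP H|].
    by rewrite exprD {2}H divff // expf_neq0.
  by rewrite addn_gt0 k0.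
by move=> n0; rewrite mulf_neq0 ?invr_eq0 ?sub_inv // -[w in w - _]expr1 sub_inv.
Qed.

Lemma qfacS n : qfac w n.+1 = qfac w n * qnum w n.+1.
Proof. by rewrite /qfac big_nat_recr. Qed.

Lemma qfac_neq0 n : qfac w n != 0.
Proof.
by elim: n => [|n IH]; [rewrite /qfac big_geq ?oner_neq0|
  rewrite qfacS mulf_neq0 ?qnum_neq0].
Qed.

Lemma qbin0 m : qbin w m 0 = 1.
Proof. by rewrite /qbin subn0 {2}/qfac big_geq // mul1r divff ?qfac_neq0. Qed.

Lemma qbinn m : qbin w m m = 1.
Proof. by rewrite /qbin subnn {3}/qfac big_geq // mulr1 divff ?qfac_neq0. Qed.

(** Both sides are [m]! / ([k]! [m-k-1]!). *)
Lemma qbin_next m k : (k < m)%N ->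
  qbin w m k.+1 * qnum w k.+1 = qbin w m k * qnum w (m - k).
Proof.
move=> km; rewrite /qbin -(subnSK km) !qfacS.
by field; rewrite !qnum_neq0 ?qfac_neq0.
Qed.

Lemma qbin_pascal m k : (k < m)%N ->
  qbin w m.+1 k.+1 = w ^+ k.+1 * qbin w m k.+1 + w ^- (m - k) * qbin w m k.
Proof.
move=> km; rewrite /qbin subSS -(subnSK km); set l := (m - k.+1)%N.
have E1 : m.+1 = (k.+1 + l.+1)%N by rewrite /l subnSK // addSn subnKC // ltnW.
rewrite !qfacS.
have -> : qnum w m.+1 = w ^+ k.+1 * qnum w l.+1 + w ^- l.+1 * qnum w k.+1.
  have ww : w - w^-1 != 0.
    by have := qnum_neq0 (ltn0Sn 0); apply: contraNneq => H; rewrite /qnum H invr0 mulr0.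
  rewrite E1 /qnum !mulrA -mulrDl; congr (_ / _).
  by rewrite exprD; set x := _ ^+ k.+1; set y := _ ^+ l.+1; field; rewrite !expf_neq0.
by field; rewrite !qnum_neq0 ?qfac_neq0 // expf_neq0.
Qed.

(** Partial alternating sums have a closed form, and q-Pascal is the step from one
    to the next. *)
Lemma qbin_alt_partial m n : (n <= m)%N ->
  \sum_(k < n.+1) (-1) ^+ k * qbin w m.+1 k * (w ^+ m) ^+ k =
    (-1) ^+ n * qbin w m n * w ^+ (n * m.+1).
Proof.
elim: n => [|n IH] nm.
  by rewrite big_ord_recr big_ord0 /= !qbin0 !mulr1 add0r.
rewrite big_ord_recr /= (IH (ltnW nm)) qbin_pascal //.
have -> : (w ^+ m) ^+ n.+1 = w ^+ (n * m.+1) * w ^+ (m - n).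
  rewrite -exprM -exprD; congr (_ ^+ _).
  by rewrite !mulnS [(m * n)%N]mulnC addnAC subnKC // ltnW.
have -> : w ^+ (n.+1 * m.+1) = w ^+ (n * m.+1) * w ^+ (m - n) * w ^+ n.+1.
  rewrite -!exprD; congr (_ ^+ _).
  by rewrite mulSn addnC -addnA [(m - n + _)%N]addnS subnK // ltnW.
by rewrite exprS; field; rewrite expf_neq0.
Qed.

(** The full sum vanishes, since its last term is the opposite of the last partial
    sum. *)
Lemma qbin_alt m : (0 < m)%N ->
  \sum_(k < m.+1) (-1) ^+ k * qbin w m k * (w ^+ m.-1) ^+ k = 0.
Proof.
case: m => // m _; rewrite big_ord_recr /= qbin_alt_partial //.
by rewrite !qbinn !mulr1 -exprM exprS [(m * _)%N]mulnC mulN1r mulNr subrr.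
Qed.

(** The sum over l is what a twisted derivation, of ratio w^2, produces from an
    n-th power. *)
Lemma geom_qnum n : w * \sum_(l < n) (w ^+ 2) ^+ l = w ^+ n * qnum w n.
Proof.
have ww : w ^+ 2 - 1 != 0 by rewrite subr_eq0 w_gen.
apply: (mulIf ww); rewrite -mulrA [_ * (w ^+ 2 - 1)]mulrC -subrX1 /qnum -exprM.
have -> : w - w^-1 = (w ^+ 2 - 1) / w by field.
by rewrite mul2n -addnn exprD; field; rewrite ww w0 expf_neq0.
Qed.

(** The two ways to obtain X^k Y X^(m-1-k) from the Serre element, by removing an
    X after or before the Y, have the same coefficient up to the sign. *)
Lemma qbin_geom m k : (k < m)%N ->
  qbin w m k * (w ^+ 2) ^+ k * w ^- m.-1 * \sum_(l < m - k) (w ^+ 2) ^+ l =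
    qbin w m k.+1 * \sum_(l < k.+1) (w ^+ 2) ^+ l.
Proof.
move=> km; apply: (mulfI w0); rewrite mulrCA geom_qnum [RHS]mulrCA geom_qnum.
rewrite [RHS]mulrCA (qbin_next km).
have -> : w ^+ (m - k) = w * w ^+ m.-1 / w ^+ k.
  case: m km => // m km; rewrite -exprS /= -exprB ?unitfE //; exact: ltnW.
by rewrite -exprM mul2n -addnn exprD exprS; field; rewrite !expf_neq0.
Qed.
End QBinomials.

(** * Skew commutation of a generator with a Serre element *)
Section SkewCommutation.
Variables (E : fieldType) (G : choiceType) (rel : freealg E G -> Prop).
Notation A := (presalg rel).
Variables (g X Y : A) (a b c1 c2 : E).
Hypothesis gX : g * X = a *: (X * g) + c1 *: (1 : A).
Hypothesis gY : g * Y = b *: (Y * g) + c2 *: (1 : A).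

Lemma skew_expr n :
  g * X ^+ n = a ^+ n *: (X ^+ n * g) + (c1 * \sum_(l < n) a ^+ l) *: X ^+ n.-1.
Proof.
elim: n => [|n IH]; first by rewrite mulr1 mul1r scale1r big_ord0 mulr0 scale0r addr0.
rewrite exprSr mulrA IH mulrDl -!pres_scalerAl -mulrA gX mulrDr -!pres_scalerAr.
rewrite mulr1 mulrA -exprSr scalerDr !scalerA -!exprSr -addrA /=; congr (_ + _).
case: n {IH} => [|n].
  by rewrite big_ord_recr !big_ord0 /= mulr0 scale0r addr0 mul1r add0r mulr1.
by rewrite -scalerDl [in RHS]big_ord_recr /= mulrDr addrC [c1 * a ^+ _]mulrC.
Qed.

Definition serre_sum (beta : nat -> E) m : A :=
  \sum_(k < m.+1) beta k *: (X ^+ k * Y * X ^+ (m - k)).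

(** When [g] moves through the sum, each X or Y that it meets leaves a constant.
    The first condition says that the constants [c1] left by the X cancel, the
    second that the constants [c2] left by the Y cancel. *)
Lemma skew_serre (beta : nat -> E) m :
  (forall k, (k < m)%N ->
    c1 * (beta k * a ^+ k * b * \sum_(l < m - k) a ^+ l
          + beta k.+1 * \sum_(l < k.+1) a ^+ l) = 0) ->
  c2 * \sum_(k < m.+1) beta k * a ^+ k = 0 ->
  g * serre_sum beta m = (a ^+ m * b) *: (serre_sum beta m * g).
Proof.
move=> H1 H2.
pose e n := \sum_(l < n) a ^+ l.
pose M k l : A := X ^+ k * Y * X ^+ l.
(* The three groups of terms are those in which nothing, an X, or Y is removed. *)
have term k : (k < m.+1)%N -> g * (beta k *: M k (m - k)%N) =
    (a ^+ m * b) *: (beta k *: (M k (m - k)%N * g))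
    + ((c1 * (beta k * a ^+ k * b * e (m - k)%N)) *: M k (m - k).-1
       + (c1 * (beta k * e k)) *: M k.-1 (m - k)%N)
    + (c2 * (beta k * a ^+ k)) *: X ^+ m.
  move=> km; rewrite /M -pres_scalerAr !mulrA skew_expr !mulrDl.
  rewrite -!pres_scalerAl -[_ * g * Y]mulrA gY mulrDr -pres_scalerAr mulrDl.
  rewrite -!pres_scalerAl mulrA -[_ * g * _]mulrA skew_expr mulrDr.
  rewrite -!pres_scalerAr mulr1 -pres_scalerAl -exprD subnKC // !mulrA.
  rewrite !scalerDr !scalerA -!addrA.
  have -> : a ^+ m = a ^+ k * a ^+ (m - k) by rewrite -exprD subnKC.
  congr (_ *: _ + _); first by ring.
  congr (_ *: _ + _); first by rewrite /e; ring.
  by rewrite addrC; congr (_ *: _ + _ *: _); rewrite /e; ring.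
rewrite /serre_sum mulr_sumr mulr_suml scaler_sumr.
rewrite (eq_bigr _ (fun (k : 'I_m.+1) _ => term k (ltn_ord k))) !big_split /=.
rewrite -scaler_suml -mulr_sumr H2 scale0r addr0.
rewrite -[X in _ = X]addr0; congr (_ + _).
  by apply: eq_bigr => k _; rewrite -pres_scalerAl.
rewrite big_ord_recr /= subnn /e big_ord0 !mulr0 scale0r addr0.
rewrite [X in _ + X]big_ord_recl /= big_ord0 !mulr0 scale0r add0r.
rewrite -big_split big1 //= => k _.
rewrite /bump /= add1n /M subnS -scalerDl -mulrDr H1 ?scale0r //.
Qed.
End SkewCommutation.

(** * The exponents of q given by the root data *)
Notation qh := q_Qqhalf.

Lemma qh_neq0 : qh != 0.
Proof. by rewrite expf_neq0 // tofrac_eq0 polyX_eq0. Qed.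

Lemma qh_gen n : (0 < n)%N -> qh ^+ n != 1.
Proof.
move=> n0; rewrite /q_Qqhalf -exprM /qhalf -tofracXn -tofrac1 tofrac_eq.
apply/eqP => /(congr1 (size : {poly rat} -> nat)).
by rewrite size_polyXn size_poly1 => -[] /eqP; rewrite muln_eq0 (gtn_eqF n0).
Qed.

Section RootData.
Variables (I : choiceType) (D : root_data I).

Lemma qexp_gt0 i : exists2 n, (0 < n)%N & qexp D i = n%:Z.
Proof.
have [n [n0 E]] := wform_even D i; exists n => //; apply: (intr_inj (R := rat)).
by rewrite qexpE E natrM mulrAC divff // mul1r.
Qed.

Lemma rformC i j : rform D i j = rform D j i.
Proof. by apply: (intr_inj (R := rat)); rewrite !rformE wformC. Qed.

Lemma rform_qexp i j : rform D i j = qexp D i * cmat D i j.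
Proof.
apply: (intr_inj (R := rat)); rewrite intrM rformE qexpE -coroot_sroot coroot_wform.
have [n [n0 ->]] := wform_even D i.
by field; rewrite pnatr_eq0 -lt0n.
Qed.

Lemma rform_diag i : rform D i i = qexp D i * 2.
Proof. by rewrite rform_qexp (gcm_diag (cmat_gcm D)). Qed.

(** Writing c_ij = - m makes the degree 1 - c_ij of the Serre element a successor
    and turns q_i^(c_ij) into an inverse power. *)
Lemma serre_degree i j : i != j -> exists m : nat,
  absz (1 - coroot D i (sroot D j)) = m.+1 /\ cmat D i j = - m%:Z.
Proof.
move=> ij; rewrite coroot_sroot.
have := gcm_offdiag (cmat_gcm D) (elimN eqP ij).
by case: (cmat D i j) => [[|n]|n] // _; [exists 0%N | exists n.+1].
Qed.

Definition serre_coef (E : fieldType) (q : E) i m k : E :=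
  (-1) ^+ k * qbinom D q i m k.

Definition serre_letters (X : Type) (x y : X) (k l : nat) : seq X :=
  nseq k x ++ y :: nseq l x.

Lemma serreE (E : fieldType) (q : E) (X : choiceType) (h : I -> X) i j m :
  absz (1 - coroot D i (sroot D j)) = m ->
  serre D q (freegen E \o h) i j =
    \sum_(k < m.+1) serre_coef q i m k *:
      word E (serre_letters (h i) (h j) k (m - k)).
Proof.
move=> Em; rewrite /serre Em; apply: eq_bigr => k _.
by rewrite /serre_letters word_cat word_cons !word_nseq mulrA.
Qed.

(* In the following, v i stands for q_i. *)
Notation v i := (qi D qh i).
Notation scoefq := (serre_coef qh).

Lemma qi_neq0 i : v i != 0.
Proof. by rewrite /qi expfz_neq0 // qh_neq0. Qed.

Lemma qi_gen i n : (0 < n)%N -> v i ^+ n != 1.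
Proof.
move=> n0; rewrite /qi; have [k k0 ->] := qexp_gt0 i.
by rewrite -[_ ^ k%:Z]/(_ ^+ k) -exprM qh_gen // muln_gt0 k0.
Qed.

Lemma qh_rform_diag i : qh ^ rform D i i = v i ^+ 2.
Proof. by rewrite rform_diag /qi -exprz_exp. Qed.

Lemma qh_rform i j m : cmat D i j = - m%:Z -> qh ^ rform D i j = v i ^- m.
Proof.
move=> E; rewrite rform_qexp E /qi.
by rewrite -exprz_exp -exprz_inv -exprVn.
Qed.

Definition lev (g : I * int) : int := g.2.
(** The commutation relation reads g h = scoef g h *: h g + dcoef g h when the
    level of [g] is the lower one. *)
Definition scoef (g h : I * int) : Qqhalf :=
  qh ^ ((-1) ^ (h.2 - g.2 + 1) * rform D g.1 h.1).
Definition dcoef (g h : I * int) : Qqhalf :=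
  (h == (g.1, g.2 + 1))%:R * (1 - v g.1 ^+ 2).

Lemma dcoef_adj g h : lev h != lev g + 1 -> dcoef g h = 0.
Proof.
move=> gh; rewrite /dcoef; case: eqP => [E|]; last by rewrite mul0r.
by move: gh; rewrite /lev E eqxx.
Qed.

Lemma dcoefP g h : dcoef g h = 0 \/ h.1 = g.1 /\ h.2 = g.2 + 1.
Proof.
rewrite /dcoef; case: eqP => [->|_]; first by right.
by left; rewrite mul0r.
Qed.

Lemma sign_shift (n : int) : (-1) ^ (n + 1) = - (-1) ^ n :> int.
Proof. by rewrite exprzDr ?unitrN1 // mulrN1. Qed.

Lemma scoef_neq0 g h : scoef g h != 0.
Proof. by rewrite expfz_neq0 ?qh_neq0. Qed.

Lemma scoef_inv1 g f h : lev g < lev f -> lev f < lev h ->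
  scoef g f * scoef g h * dcoef f h = dcoef f h.
Proof.
move=> _ _; case: (dcoefP f h) => [->|[E1 E2]]; first by rewrite mulr0.
rewrite /scoef -expfzDr ?qh_neq0 // E1 E2.
have -> : f.2 + 1 - g.2 + 1 = (f.2 - g.2 + 1) + 1 by ring.
by rewrite [_ ^ (_ + 1 + 1)]sign_shift mulNr subrr expr0z mul1r.
Qed.

Lemma scoef_inv2 g f h : lev g < lev f -> lev f < lev h ->
  scoef f h * scoef g h * dcoef g f = dcoef g f.
Proof.
move=> _ _; case: (dcoefP g f) => [->|[E1 E2]]; first by rewrite mulr0.
rewrite /scoef -expfzDr ?qh_neq0 // E1 E2.
have -> : h.2 - g.2 + 1 = (h.2 - (g.2 + 1) + 1) + 1 by ring.
by rewrite [_ ^ (_ + 1 + 1)]sign_shift mulNr subrr expr0z mul1r.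
Qed.

Notation T := (freealg Qqhalf (I * int)%type).
Notation brel := (boson_rel lev scoef dcoef).
Notation F := (presalg brel).
Notation pr := (presproj brel).
Notation fr := (freegen Qqhalf).

Definition level_serre i j p : T := serre D qh ((@fgen I)^~ p) i j.

Lemma pr_boson g f : lev g < lev f ->
  pr (fr g) * pr (fr f) =
    scoef g f *: (pr (fr f) * pr (fr g)) + dcoef g f *: (1 : F).
Proof. exact: presproj_boson. Qed.

(** The commutation relation read backwards, to move a generator of higher level to the
    right. *)
Lemma pr_boson_up g f : lev f < lev g ->
  pr (fr g) * pr (fr f) =
    (scoef f g)^-1 *: (pr (fr f) * pr (fr g))
    + (- (scoef f g)^-1 * dcoef f g) *: (1 : F).
Proof.
move=> /pr_boson ->; rewrite scalerDr !scalerA mulVf ?scoef_neq0 // scale1r.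
by rewrite mulNr scaleNr addrK.
Qed.

Lemma pr_serre i j p m : absz (1 - coroot D i (sroot D j)) = m ->
  pr (level_serre i j p) =
    serre_sum (pr (fr (i, p))) (pr (fr (j, p))) (scoefq i m) m.
Proof.
move=> E; rewrite /level_serre /serre E linear_sum /serre_sum; apply: eq_bigr => k _ /=.
by rewrite linearZ /= !rmorphM !rmorphXn.
Qed.

Lemma serre_coef_alt i m w : w = v i \/ w = (v i)^-1 ->
  \sum_(k < m.+2) scoefq i m.+1 k * (w ^+ m) ^+ k = 0.
Proof.
move=> hw; have w0 : w != 0 by case: hw => ->; rewrite ?invr_eq0 qi_neq0.
have wg n : (0 < n)%N -> w ^+ n != 1.
  by move=> n0; case: hw => ->; rewrite ?exprVn ?invr_eq1 qi_gen.
apply: etrans (qbin_alt w0 wg (ltn0Sn m)); apply: eq_bigr => k _; congr (_ * _ * _).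
by case: hw => ->; rewrite ?qbinV.
Qed.

Lemma serre_coef_geom i m w k : w = v i \/ w = (v i)^-1 -> (k < m.+1)%N ->
  scoefq i m.+1 k * (w ^+ 2) ^+ k * w ^- m * \sum_(l < m.+1 - k) (w ^+ 2) ^+ l
  + scoefq i m.+1 k.+1 * \sum_(l < k.+1) (w ^+ 2) ^+ l = 0.
Proof.
move=> hw km; have w0 : w != 0 by case: hw => ->; rewrite ?invr_eq0 qi_neq0.
have wg n : (0 < n)%N -> w ^+ n != 1.
  by move=> n0; case: hw => ->; rewrite ?exprVn ?invr_eq1 qi_gen.
have cE l : scoefq i m.+1 l = (-1) ^+ l * qbin w m.+1 l.
  by rewrite /serre_coef; congr (_ * _); case: hw => ->; rewrite ?qbinV.
rewrite !cE -!(mulrA ((-1) ^+ _)).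
by rewrite (qbin_geom w0 wg km) [(-1) ^+ k.+1]exprS mulN1r mulNr subrr.
Qed.

(** A constant term can only come from the level just below or just above [p], and
    from the colour i or j, never both since i and j differ. In the first case the
    ratio is a = w^2 and b = w^-m, in the second a = w^m, with w = q_i or q_i^-1;
    these are the values for which the constants cancel. *)
Lemma serre_skew_comm g i j p : i != j -> lev g != p ->
  exists2 c, c != 0 &
    pr (fr g * level_serre i j p) = c *: pr (level_serre i j p * fr g).
Proof.
move=> ij gp; have [m [Em Ec]] := serre_degree ij.
pose A := pr (fr g).
suff [a [b [c1 [c2 [gX gY [a0 b0] H]]]]] : exists a b c1 c2 : Qqhalf,
   [/\ A * pr (fr (i, p)) = a *: (pr (fr (i, p)) * A) + c1 *: (1 : F),
       A * pr (fr (j, p)) = b *: (pr (fr (j, p)) * A) + c2 *: (1 : F),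
       a != 0 /\ b != 0 &
       (c1 = 0 \/ exists2 w, w = v i \/ w = (v i)^-1 & a = w ^+ 2 /\ b = w ^- m) /\
       (c2 = 0 \/ exists2 w, w = v i \/ w = (v i)^-1 & a = w ^+ m)].
  exists (a ^+ m.+1 * b); first exact: mulf_neq0 (expf_neq0 _ a0) b0.
  rewrite !rmorphM /= !(pr_serre _ Em) (skew_serre gX gY) //.
    move=> k km; case: H => -[->|[w hw [-> ->]]] _; first by rewrite mul0r.
    by rewrite serre_coef_geom ?mulr0.
  case: H => _ [->|[w hw ->]]; first by rewrite mul0r.
  by rewrite serre_coef_alt ?mulr0.
have [lt|ge] := ltP (lev g) p.
  exists (scoef g (i, p)), (scoef g (j, p)), (dcoef g (i, p)), (dcoef g (j, p)).
  split; [exact: pr_boson|exact: pr_boson|by split; exact: scoef_neq0|split].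
    case: (dcoefP g (i, p)) => [->|[/= gi gl]]; first by left.
    right; exists (v i); first by left.
    rewrite /scoef /= gl -gi.
    have -> : g.2 + 1 - g.2 + 1 = 2 by ring.
    by rewrite mul1r qh_rform_diag mul1r (qh_rform Ec).
  case: (dcoefP g (j, p)) => [->|[/= gj gl]]; first by left.
  right; exists (v i)^-1; first by right.
  rewrite /scoef /= gl -gj.
  have -> : g.2 + 1 - g.2 + 1 = 2 by ring.
  by rewrite mul1r rformC (qh_rform Ec) exprVn.
have {gp ge} lt : p < lev g by rewrite lt_neqAle eq_sym gp.
exists (scoef (i, p) g)^-1, (scoef (j, p) g)^-1.
do 2!eexists; split; [exact: pr_boson_up|exact: pr_boson_up|..].
  by split; rewrite invr_eq0 scoef_neq0.
split.
  case: (dcoefP (i, p) g) => [->|[/= gi gl]]; first by left; rewrite mulr0.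
  right; exists (v i)^-1; first by right.
  rewrite /scoef /= gl gi.
  have -> : p + 1 - p + 1 = 2 by ring.
  by rewrite !mul1r qh_rform_diag rformC (qh_rform Ec) !exprVn.
case: (dcoefP (j, p) g) => [->|[/= gj gl]]; first by left; rewrite mulr0.
right; exists (v i); first by left.
rewrite /scoef /= gl gj.
have -> : p + 1 - p + 1 = 2 by ring.
by rewrite mul1r (qh_rform Ec) invrK.
Qed.

End RootData.

(** * Normal forms of the ideal of relations *)
Lemma quotmod_ext (R : nzRingType) (V M : lmodType R) (S : V -> Prop)
    (f : {linear V -> M}) : (forall x, S x -> f x = 0) ->
  exists g : {linear quotmod S -> M}, forall x, g (qproj S x) = f x.
Proof.
move=> fS; have f0 x : span S x -> f x = 0.
  by elim=> [|a u v Su _ IH]; rewrite ?linear0 // linearP IH fS // scaler0 addr0.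
pose g (t : quotmod S) : M := f (repr t).
have gE x : g (qproj S x) = f x.
  apply/eqP; rewrite -subr_eq0 -linearB; apply/eqP/f0.
  by rewrite -opprB -scaleN1r; apply/spanZ/qproj_repr.
have g_lin : linear g.
  move=> a s t; have [x ->] := qproj_surj s; have [y ->] := qproj_surj t.
  by rewrite -qproj_is_linear !gE linearP.
pose gM := GRing.isLinear.Build R _ M *:%R g g_lin.
pose gL : {linear quotmod S -> M} := HB.pack g gM.
by exists gL.
Qed.

Section NormalOrdering.
Variables (I : choiceType) (D : root_data I).
Notation K := Qqhalf.
Notation G := (I * int)%type.
Notation T := (freealg K G).
Notation word := (word K).
Notation fr := (freegen K).
Notation lev := (@lev I).
Notation act := (act lev (scoef D) (dcoef D)).
Notation nact := (nact lev (scoef D) (dcoef D)).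
Notation tact := (tact lev (scoef D) (dcoef D)).
Notation ordered := (ordered lev).
Notation ospan := (ospan lev).
Notation S := (level_serre D).

Let adj := @dcoef_adj I D.
Let inv1 := @scoef_inv1 I D.
Let inv2 := @scoef_inv2 I D.

Lemma level_serreE i j p m : absz (1 - coroot D i (sroot D j)) = m ->
  S i j p = \sum_(k < m.+1) serre_coef D qh i m k *:
    word (serre_letters (i, p) (j, p) k (m - k)).
Proof. exact: (serreE qh (fun i : I => (i, p))). Qed.

Lemma serre_letters_level i j p k l :
  all (fun g : G => lev g == p) (serre_letters (i, p) (j, p) k l).
Proof. by rewrite all_cat /= !all_nseq /= eqxx !orbT. Qed.

Lemma ordered_level p w : all (fun g => lev g == p) w -> ordered w.
Proof.
elim: w => // g w IH /= /andP[/eqP gp wp]; rewrite ordered_cons IH // andbT.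
by apply: sub_all wp => h /eqP ->; rewrite gp.
Qed.

(** The relations that remain among ordered words: a Serre element standing where a
    letter of its level may stand. *)
Variant serre_word (Q : pred int) : T -> Prop :=
  SerreWord i j p u w : i != j -> ordered u -> ordered w ->
    all (fun g => p <= lev g) u -> all (fun g => lev g <= p) w ->
    Q p -> all (Q \o lev) u -> all (Q \o lev) w ->
    serre_word Q (word u * S i j p * word w).

Notation J Q := (span (serre_word Q)).

Lemma serre_word_ospan Q x : serre_word Q x -> ospan Q x.
Proof.
case=> i j p u w _ ou ow up wp Qp Qu Qw.
rewrite (level_serreE p erefl) mulr_sumr mulr_suml.
elim/big_rec: _ => [|k y _ IH]; first exact: span0.
rewrite -scalerAr -scalerAl -!word_cat; apply: spanD IH; apply: spanZ.
set sl := serre_letters _ _ _ _.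
have lp := serre_letters_level i j p k (absz (1 - coroot D i (sroot D j)) - k).
have slp : all (fun g => p <= lev g) sl by apply: sub_all lp => g /eqP ->.
apply: ospan_word.
  apply: (ordered_cat (p := p)) => //; last by rewrite all_cat up.
  apply: (ordered_cat (p := p)) => //; first exact: ordered_level lp.
  by apply: sub_all lp => g /eqP ->.
have Qs : all (Q \o lev) sl by apply: sub_all lp => g /= /eqP ->.
by rewrite all_cat Qw andbT all_cat Qu.
Qed.

(** The letters of a Serre element have the same level, so no straightening takes
    place in front of lower letters. *)
Lemma tact_serre_low i j p v : ospan (fun k => k <= p) v ->
  tact v (S i j p) = S i j p * v.
Proof.
move=> ov; rewrite (level_serreE p erefl) linear_sum mulr_suml.
apply: eq_bigr => k _; rewrite linearZ /= -scalerAl tact_word; congr (_ *: _).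
have lp := serre_letters_level i j p k (absz (1 - coroot D i (sroot D j)) - k).
apply: (@nact_ordered _ _ _ _ _ p); rewrite ?(ordered_level lp) //.
by apply: sub_all lp => g /eqP ->.
Qed.

Lemma act_serre g i j p v : i != j -> lev g != p -> ospan any_level v ->
  exists2 c, c != 0 & act g (tact v (S i j p)) = c *: tact (act g v) (S i j p).
Proof.
move=> ij gp ov; have [c c0 E] := serre_skew_comm D ij gp; exists c => //.
have /(tact_boson adj inv1 inv2 ov) : span (ideal_gen (boson_rel lev (scoef D) (dcoef D)))
    (fr g * S i j p - c *: (S i j p * fr g)).
  by apply/qprojP; apply: etrans E _; exact/esym/linearZ.
rewrite linearB linearZ /= !tactM !tact_gen => /eqP.
by rewrite subr_eq0 => /eqP.
Qed.

Lemma serre_word_cons (Q : pred int) g x : Q (lev g) ->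
  J (upto Q (lev g)) x -> J Q (fr g * x).
Proof.
move=> Qg; elim=> [|a _ v [i j p u w ij ou ow up wp /andP[Qp pg] Qu Qw] _ IH].
  by rewrite mulr0; exact: span0.
rewrite mulrDr -scalerAr !mulrA -word_cons; apply: spanD IH; apply: spanZ.
apply: span_incl; apply: SerreWord => //=.
- by rewrite ordered_cons ou andbT; apply: sub_all Qu => h /andP[].
- by rewrite pg.
- by rewrite Qg /=; apply: sub_all Qu => h /andP[].
- by apply: sub_all Qw => h /andP[].
Qed.

Lemma serre_mul_low (Q : pred int) i j p v : i != j -> Q p ->
  ospan (upto Q p) v -> J Q (S i j p * v).
Proof.
move=> ij Qp; elim=> [|a _ y [w /andP[ow Qw] ->] _ IH].
  by rewrite mulr0; exact: span0.
rewrite mulrDr -scalerAr; apply: spanD IH; apply: spanZ; apply: span_incl.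
rewrite -[S i j p]mul1r -word_nil; apply: SerreWord => //.
- by apply: sub_all Qw => h /andP[].
- by apply: sub_all Qw => h /andP[].
Qed.

(** Induction on the part [u] in front of the Serre element. The new letter is put
    in front if it is of maximal level; it passes the letters of [u] of higher
    level, leaving terms of the same shape; and it passes the Serre element by
    skew commutation [act_serre], to be inserted in the part behind. *)
Lemma act_serre_span (Q : pred int) g : Q (lev g) -> forall x, J Q x -> J Q (act g x).
Proof.
move=> Qg; apply: span_linear => _ [i j p u w ij ou ow up wp Qp Qu Qw] /=.
elim: u Q Qg Qp ou up Qu Qw => [|h u IH] Q Qg Qp ou up Qu Qw.
  rewrite word_nil mul1r; have olow : ospan (upto Q p) (word w).
    by apply: ospan_word => //; rewrite all_upto Qw.
  have ov : ospan (fun k => k <= p) (word w) by exact: ospan_word.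
  have [gp|pg] := ltP (lev g) p.
    rewrite -tact_serre_low //.
    have [c _ ->] := act_serre ij (negbT (lt_eqF gp)) (ospanS (fun _ _ => isT) ov).
    apply: spanZ; rewrite tact_serre_low.
      apply: serre_mul_low => //; apply: act_ospan => //=.
      by rewrite /upto Qg ltW.
    by apply: act_ospan ov; exact: ltW.
  rewrite act_top.
    rewrite mulrA -word1; apply: span_incl.
    by apply: SerreWord => //=; rewrite ?pg ?Qg.
  apply: (@serre_word_ospan (fun k => k <= lev g)).
  rewrite -[S i j p]mul1r -word_nil; apply: SerreWord => //.
  by apply: sub_all wp => k /= /le_trans; apply.
move: (ou) (up) (Qu); rewrite ordered_cons /=.
move=> /andP[hu ou'] /andP[ph up'] /andP[Qh Qu'].
have wh : all (fun k => lev k <= lev h) w.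
  by apply: sub_all wp => k /le_trans; apply.
have [gh|hg] := ltP (lev g) (lev h).
  rewrite word_cons -!mulrA act_pass //; apply: spanD; apply: spanZ; last first.
    by rewrite mulrA; apply: span_incl; apply: SerreWord.
  apply: serre_word_cons => //; rewrite mulrA; apply: IH => //=.
  - by rewrite /upto Qg ltW.
  - by rewrite /upto Qp.
  - by rewrite all_upto Qu'.
  - by rewrite all_upto Qw.
have ug : all (fun k => lev k <= lev g) (h :: u).
  by rewrite /= hg /=; apply: sub_all hu => k /= /le_trans; apply.
rewrite act_top.
  rewrite !mulrA -word_cons; apply: span_incl; apply: SerreWord => //.
  - by rewrite ordered_cons ug.
  - by rewrite /= (le_trans ph hg).
  - by rewrite /= Qg Qh.
apply: (@serre_word_ospan (fun k => k <= lev g)); apply: SerreWord => //.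
  exact: le_trans hg.
by apply: sub_all wh => k /= /le_trans; apply.
Qed.

Lemma tact_serre_span x v : J any_level v -> J any_level (tact v x).
Proof.
move=> Jv; elim/word_ind: x => [|c w x IH]; first by rewrite linear0; exact: span0.
rewrite linearP /= tact_word; apply: spanD IH; apply: spanZ.
by elim: w => //= g w IH; apply: act_serre_span.
Qed.

(** A Serre element acting on an ordered word moves, up to nonzero scalars, past
    the letters of higher level until it stands at its proper place. *)
Lemma tact_serre_in_span i j p v : i != j -> ospan any_level v -> J any_level (tact v (S i j p)).
Proof.
move=> ij; elim=> [|a _ y [w /andP[ow _] ->] _ IH].
  by rewrite tact0; exact: span0.
rewrite tactl_linear; apply: spanD IH; apply: spanZ.
elim: w ow => [|h w IH] ow.
  have o0 : ospan (fun k => k <= p) (word [::]) by exact: ospan_word.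
  rewrite tact_serre_low //; apply: serre_mul_low => //; exact: o0.
have [hp|ph] := leP (lev h) p.
  have hw : all (fun k => lev k <= p) (h :: w).
    move: ow; rewrite ordered_cons /= hp => /andP[ow _].
    by apply: sub_all ow => k /le_trans; apply.
  have o0 : ospan (fun k => k <= p) (word (h :: w)) by exact: ospan_word.
  rewrite tact_serre_low //; apply: serre_mul_low => //; exact: o0.
move: ow; rewrite ordered_cons => /andP[hw ow].
have [||c c0 E] := @act_serre h i j p (word w) ij; first exact: negbT (gt_eqF ph).
  exact: ospan_word (all_predT _).
rewrite word_cons -(act_top (lev := lev) (scoef D) (dcoef D)); last exact: ospan_word.
(* As c is nonzero, [act_serre] may be solved for the right-hand side. *)
rewrite -[tact _ _]scale1r -(mulVf c0) -scalerA -E.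
by apply: spanZ; apply: act_serre_span => //; apply: IH.
Qed.

Notation A := (Ahat D).
Notation pA := (presproj (@Ahat_rel I D)).

(** The condition on [phi] is needed for the levels in [Q]
    only: words with a level outside [Q] are sent to 0, and inserting the Serre
    element of a level outside [Q] produces such words. *)
Lemma Ahat_linear_ext (M : lmodType K) (Q : pred int) (phi : seq G -> M) :
  (forall i j p u w, i != j -> Q p ->
     let m := absz (1 - coroot D i (sroot D j)) in
     \sum_(k < m.+1) serre_coef D qh i m k *:
       phi (u ++ serre_letters (i, p) (j, p) k (m - k) ++ w) = 0) ->
  exists Phi : {linear A -> M}, forall w,
    ordered w -> all (Q \o lev) w -> Phi (pA (word w)) = phi w.
Proof.
move=> phi0; pose psi w := if all (Q \o lev) w then phi w else 0.
have psi_serre x : serre_word any_level x -> wext psi x = 0.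
  case=> i j p u w ij _ _ _ _ _ _ _.
  rewrite (level_serreE p erefl) mulr_sumr mulr_suml linear_sum; set m := absz _.
  pose ok := [&& all (Q \o lev) u, Q p & all (Q \o lev) w].
  transitivity (\sum_(k < m.+1) serre_coef D qh i m k *:
     (if ok then phi (u ++ serre_letters (i, p) (j, p) k (m - k) ++ w) else 0)).
    apply: eq_bigr => k _; rewrite -scalerAr -scalerAl linearZ /=.
    rewrite -!word_cat -catA wext_word /psi !all_cat /= !all_nseq /=.
    by rewrite /ok; case: (Q p); rewrite ?orbT ?andbT //= ?(andbF, orbF).
  case: (boolP ok) => [/and3P[_ Qp _]|_]; first exact: phi0.
  by rewrite big1 // => k _; rewrite scaler0.
have psiJ x : J any_level x -> wext psi x = 0.
  elim=> [|a u v Su _ IH]; first exact: linear0.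
  by rewrite linearP /= IH psi_serre // scaler0 addr0.
pose f := wext psi \o tact 1.
have o1 : ospan any_level (1 : T) by exact: ospan1.
have [x|Phi PhiE] := @quotmod_ext _ _ _ (ideal_gen (@Ahat_rel I D)) f.
  move=> [a [_ [b [[i j p ij|i j m p mp] ->]]]]; rewrite /f /=.
    rewrite !tactM; apply/psiJ/tact_serre_span/tact_serre_in_span => //.
    exact: tact_ospan.
  rewrite (tact_boson adj inv1 inv2) ?linear0 //; apply: span_incl.
  exists a; eexists; exists b; split; last by [].
  exact: (@Boson _ _ _ _ _ (i, m) (j, p)).
exists Phi => w ow Qw.
rewrite -[LHS]/(Phi (qproj _ (word w))) PhiE /f /= tact_word nact_ordered1 //.
by rewrite wext_word /psi Qw.
Qed.

Lemma ordered_span_act (a b : int) x :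
  span (fun y => exists2 w, all (fun g => (a <= lev g) && (lev g <= b)) w & y = word w) x ->
  exists2 y, ospan (fun k => (a <= k) && (k <= b)) y & pA x = pA y.
Proof.
elim=> [|c _ v [w Qw ->] _ [y oy E]].
  by exists 0; [exact: span0|].
pose z : T := nact w 1.
have oz : ospan (fun k => (a <= k) && (k <= b)) z.
  by apply: nact_ospan Qw; exact: ospan1.
exists (c *: z + y); first by apply: spanD oy; apply: spanZ.
rewrite !linearP /= E; congr (_ *: _ + _).
have sub r : boson_rel lev (scoef D) (dcoef D) r -> @Ahat_rel I D r.
  by case=> -[i k] [j l] kl; exact: Ahat_boson.
rewrite /z; elim: w {Qw z oz} => [|g w IH] /=; first by rewrite word_nil.
by rewrite (presproj_act sub) word_cons rmorphM /= IH.
Qed.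
End NormalOrdering.

(** * The multiplication map on tensors of level components *)
Section TensorChain.
Variables (R : comNzRingType) (V : int -> lmodType R).

Lemma tpure_ext (x y : forall k, V k) n b :
  (forall k, b - n%:Z <= k -> k <= b -> x k = y k) ->
  tpure x n b = tpure y n b.
Proof.
elim: n b => [|n IH] b xy /=; first by apply: xy => //; rewrite subr0.
rewrite (xy b) //; last by lia.
by congr (tens _ _); apply: IH => k k1 k2; apply: xy; lia.
Qed.

Lemma tpure_linear (x : forall k, V k) n b p : b - n%:Z <= p -> p <= b ->
  linear (fun y : V p => tpure (dfwith x y) n b).
Proof.
elim: n b => [|n IH] b pb1 pb2 a y y' /=.
  have E : p = b by lia.
  by subst p; rewrite !dfwith_in.
have [E|ne] := eqVneq p b.
  subst p; rewrite !dfwith_in.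
  have out (z : V b) : tpure (dfwith x z) n (b - 1) = tpure x n (b - 1).
    apply: tpure_ext => k k1 k2; apply: dfwith_out.
    have bk : b <> k by lia.
    exact/eqP.
  by rewrite !out tens_linl.
have /= -> := IH (b - 1) _ _ a y y'; [|lia|move/eqP: ne; lia].
by rewrite !dfwith_out // tens_linr.
Qed.

Lemma tens_span (U W : lmodType R) (SU : U -> Prop) (SW : W -> Prop) u w :
  span SU u -> span SW w ->
  span (fun t => exists u' w', [/\ SU u', SW w' & t = tens u' w']) (tens u w).
Proof.
move=> su sw; elim: su => [|a u1 u2 Su _ IHu].
  by have := tensZl 0 (0 : U) w; rewrite !scale0r => ->; exact: span0.
rewrite tens_linl; apply: spanD IHu; apply: spanZ.
elim: sw => [|c w1 w2 Sw _ IHw].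
  by have := tensZr 0 u1 (0 : W); rewrite !scale0r => ->; exact: span0.
rewrite tens_linr; apply: spanD IHw; apply: spanZ.
by apply: span_incl; exists u1, w1.
Qed.

End TensorChain.

Lemma filter_none (X : Type) (a : pred X) s :
  all (fun x => ~~ a x) s -> filter a s = [::].
Proof. by elim: s => //= x s IH /andP[/negbTE -> /IH]. Qed.

Lemma filter_cat3 (X : Type) (a : pred X) u s w :
  filter a (u ++ s ++ w) = filter a u ++ filter a s ++ filter a w.
Proof. by rewrite !filter_cat. Qed.

Section Intervals.
Variables (I : choiceType) (D : root_data I).
Notation K := Qqhalf.
Notation G := (I * int)%type.
Notation T := (freealg K G).
Notation word := (word K).
Notation lev := (@lev I).
Notation ordered := (ordered lev).
Notation ospan := (ospan lev).
Notation A := (Ahat D).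
Notation pA := (presproj (@Ahat_rel I D)).
Notation B := (fun k => Ahat_int D k k).

Definition within (a b : int) : pred int := fun k => (a <= k) && (k <= b).

Lemma subalg_scalerAl a b (c : K) (x y : Ahat_int D a b) : (c *: x) * y = c *: (x * y).
Proof. by apply: val_inj; rewrite /= pres_scalerAl. Qed.
Lemma subalg_scalerAr a b (c : K) (x y : Ahat_int D a b) : x * (c *: y) = c *: (x * y).
Proof. by apply: val_inj; rewrite /= pres_scalerAr. Qed.

Lemma word_subalg a b w : all (within a b \o lev) w ->
  pA (word w) \in in_subalg (fun x : A => exists i k, [/\ a <= k, k <= b & x = Agen D i k]).
Proof.
elim: w => [|g w IH] /=; first by rewrite word_nil rmorph1 rpred1.
move=> /andP[/andP[ga gb] /IH wi]; rewrite word_cons rmorphM rpredM //.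
by apply/in_subalgP/gen_incl; exists g.1, g.2; split => //; case: (g).
Qed.

Lemma subalg_words a b (x : Ahat_int D a b) : exists2 y,
  span (fun y => exists2 w, all (within a b \o lev) w & y = word w) y & val x = pA y.
Proof.
have /in_subalgP := valP x.
elim=> [_ [i [k [ak kb ->]]]||c _ _ _ [y sy ->] _ [z sz ->]|
  _ _ _ [y sy ->] _ [z sz ->]].
- exists (freegen K (i, k)); last by [].
  apply: span_incl; exists [:: (i, k)];
    by rewrite ?word1 //= /within ak kb.
- exists 1; last by rewrite rmorph1.
  by apply: span_incl; exists [::]; rewrite ?word_nil.
- by exists (c *: y + z); [apply: spanD => //; apply: spanZ | rewrite linearP].
exists (y * z); last by rewrite rmorphM.
elim: sy => [|c _ y' [u Qu ->] _ IH]; first by rewrite mul0r; exact: span0.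
rewrite mulrDl -scalerAl; apply: spanD IH; apply: spanZ.
elim: sz => [|d _ z' [w Qw ->] _ IH]; first by rewrite mulr0; exact: span0.
rewrite mulrDr -scalerAr; apply: spanD IH; apply: spanZ.
by apply: span_incl; exists (u ++ w); rewrite ?word_cat // all_cat Qu.
Qed.

Lemma subalg_ordered a b (x : Ahat_int D a b) :
  exists2 y, ospan (within a b) y & val x = pA y.
Proof.
by have [y sy ->] := subalg_words x; have [z oz ->] := ordered_span_act D sy; exists z.
Qed.

(** The product of the letters of level [k] of [w], as an element of the
    subalgebra. The default value 1 never occurs, as [val_wprod] shows. *)
Definition wprod (k : int) (w : seq G) : Ahat_int D k k :=
  insubd (1 : Ahat_int D k k) (pA (word [seq g <- w | lev g == k])).

Lemma val_wprod k w : val (wprod k w) = pA (word [seq g <- w | lev g == k]).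
Proof.
rewrite val_insubd word_subalg //; apply/allP => g.
by rewrite mem_filter => /andP[/eqP gk _]; rewrite /= gk /within lexx.
Qed.

Lemma wprod_cat_out k u w : all (fun g => lev g != k) w -> wprod k (u ++ w) = wprod k u.
Proof.
move=> wk; apply: val_inj; rewrite !val_wprod filter_cat.
by rewrite (filter_none wk) cats0.
Qed.

Lemma wprod_out_cat k u w : all (fun g => lev g != k) u -> wprod k (u ++ w) = wprod k w.
Proof.
move=> wk; apply: val_inj; rewrite !val_wprod filter_cat.
by rewrite (filter_none wk).
Qed.

Lemma subalg_wprod k (x : Ahat_int D k k) :
  span (fun y => exists2 w, all (fun g => lev g == k) w & y = wprod k w) x.
Proof.
have [y sy E] := subalg_words x.
suff [z sz Ez] : exists2 z : Ahat_int D k k,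
  span (fun y => exists2 w, all (fun g => lev g == k) w & y = wprod k w) z & val z = pA y.
  by rewrite (_ : x = z) //; apply: val_inj; rewrite E.
elim: sy {x E} => [|c _ y' [w Qw ->] _ [z sz Ez]].
  by exists 0; [exact: span0 | rewrite !linear0].
have wk : all (fun g => lev g == k) w.
  by apply: sub_all Qw => g; rewrite /= /within eq_le andbC.
exists (c *: wprod k w + z).
  by apply: spanD sz; apply: spanZ; apply: span_incl; exists w.
by rewrite /= linearP /= -Ez val_wprod (all_filterP wk).
Qed.

Notation chain := (tchain B).
Definition wpure n b w : chain n b := tpure (wprod^~ w) n b.

(** Pure tensors of words of the single levels come from one ordered word, their
    concatenation. *)
Lemma tchain_words n b (t : chain n b) :
  span (fun t => exists2 w, ordered w && all (within (b - n%:Z) b \o lev) w & t = wpure n b w) t.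
Proof.
elim: n b t => [|n IH] b t.
  apply: span_sub (subalg_wprod t) => _ [w wb ->]; exists w => //.
  rewrite (ordered_level wb); apply: sub_all wb => g /eqP /=.
  by rewrite /within /= subr0 => ->; rewrite lexx.
elim/tensor_ind: t => [|v t s IHs]; first exact: span0.
apply: spanD IHs; apply: span_sub (tens_span (subalg_wprod v) (IH _ t)).
move=> _ [_ [_ [[u ub ->] [w /andP[ow Qw] ->] ->]]]; exists (u ++ w).
  rewrite (ordered_cat (p := b)) ?(ordered_level ub) //=.
  - rewrite all_cat; apply/andP; split.
      by apply: sub_all ub => g /eqP /=; rewrite /within => ->; lia.
    by apply: sub_all Qw => g /=; rewrite /within; lia.
  - by apply: sub_all ub => g /eqP ->.
  - by apply: sub_all Qw => g /=; rewrite /within; lia.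
rewrite /wpure /= wprod_cat_out; last by apply: sub_all Qw => g /=; rewrite /within; lia.
congr (tens _ _); apply: tpure_ext => k k1 k2; rewrite wprod_out_cat //.
by apply: sub_all ub => g /eqP ->; lia.
Qed.

Lemma ordered_split b w : ordered w -> all (fun g => lev g <= b) w ->
  w = [seq g <- w | lev g == b] ++ [seq g <- w | lev g < b].
Proof.
elim: w => // g w IH; rewrite ordered_cons /= => /andP[gw ow] /andP[gb wb].
have [E|ne] := eqVneq (lev g) b; first by rewrite E ltxx /= {1}IH.
have gl : lev g < b by rewrite lt_neqAle ne.
have wl h : h \in w -> lev h < b by move/(allP gw) => /le_lt_trans; apply.
rewrite gl filter_none /=; last by apply/allP => h /wl /lt_eqF ->.
by congr (_ :: _); apply/esym/all_filterP/allP.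
Qed.

Lemma prod_wprod n b w : ordered w -> all (within (b - n%:Z) b \o lev) w ->
  \prod_(0 <= r < n.+1) val (wprod (b - r%:Z) w) = pA (word w).
Proof.
elim: n b w => [|n IH] b w ow Qw.
  rewrite big_nat1 subr0 val_wprod; congr (pA (word _)); apply/all_filterP.
  by apply: sub_all Qw => g /=; rewrite /within subr0 eq_le andbC.
have wb : all (fun g => lev g <= b) w by apply: sub_all Qw => g /andP[].
have E := ordered_split ow wb; set w' := [seq g <- w | lev g < b] in E.
rewrite big_nat_recl // subr0 val_wprod [in RHS]E word_cat rmorphM /=; congr (_ * _).
rewrite -(IH (b - 1)); first last.
- apply/allP => g; rewrite mem_filter => /andP[gb /(allP Qw)] /=.
  by rewrite /within; lia.
- by apply: sorted_filter ow => x y z /= h1 h2; exact: le_trans h2 h1.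
apply: eq_big_nat => r _; have -> : b - r.+1%:Z = b - 1 - r%:Z by lia.
rewrite !val_wprod /w' -filter_predI; congr (pA (word _)); apply: eq_filter => g /=.
by apply/idP/idP => [/eqP ->|/andP[]//]; rewrite eqxx; lia.
Qed.

Fixpoint chain_mul n b : chain n b -> A :=
  if n is n'.+1 return chain n b -> A
  then fun t : tensor (B b) (chain n' (b - 1)) => tlift (fun (v : B b) t' => val v * chain_mul t') t
  else fun x : B b => val x.

Lemma chain_mul_linear n b : linear (@chain_mul n b).
Proof.
elim: n b => [|n IH] b a s t; first exact: linearP.
apply: (tlift_linear (f := fun (v : B b) t' => val v * @chain_mul n (b - 1) t')) => [w|v] c x y.
  by rewrite linearP mulrDl -pres_scalerAl.
by rewrite IH mulrDr -pres_scalerAr.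
Qed.
HB.instance Definition _ n b :=
  GRing.isLinear.Build K (chain n b) A *:%R (@chain_mul n b) (@chain_mul_linear n b).

Lemma chain_mul_pure x n b :
  chain_mul (tpure x n b) = \prod_(0 <= r < n.+1) val (x (b - r%:Z)).
Proof.
elim: n b => [|n IH] b; first by rewrite big_nat1 subr0.
rewrite big_nat_recl // subr0.
rewrite -[LHS]/(tlift (fun (v : B b) t' => val v * @chain_mul n (b - 1) t') (tens _ _)).
rewrite tliftE; first 1 last.
- by move=> w c u v; rewrite linearP mulrDl -pres_scalerAl.
- by move=> v c s t; rewrite chain_mul_linear mulrDr -pres_scalerAr.
rewrite IH; congr (_ * _); apply: eq_big_nat => r _.
by have -> : b - r.+1%:Z = b - 1 - r%:Z by lia.
Qed.

Lemma chain_mul_word n b w : ordered w -> all (within (b - n%:Z) b \o lev) w ->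
  chain_mul (wpure n b w) = pA (word w).
Proof. by move=> ow Qw; rewrite chain_mul_pure prod_wprod. Qed.

Lemma chain_mul_subalg n b (t : chain n b) : chain_mul t \in
  in_subalg (fun x : A => exists i k, [/\ b - n%:Z <= k, k <= b & x = Agen D i k]).
Proof.
elim: (tchain_words t) => [|a _ s [w /andP[ow Qw] ->] _ IH].
  by rewrite linear0 rpred0.
rewrite linearP rpredD // rpredZ //= chain_mul_word //; exact: word_subalg.
Qed.

(** Inserting letters of level [p] changes the factor of level [p] only, and the
    pure tensor depends linearly on this factor, in which the Serre relation
    holds. *)
Lemma chain_serre n b p i j u w : i != j -> b - n%:Z <= p -> p <= b ->
  let m := absz (1 - coroot D i (sroot D j)) in
  \sum_(k < m.+1) serre_coef D qh i m k *:
     wpure n b (u ++ serre_letters (i, p) (j, p) k (m - k) ++ w) = 0.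
Proof.
move=> ij p1 p2 m.
have lin := tpure_linear (V := B) (wprod^~ (u ++ w)) p1 p2.
pose f y := tpure (V := B) (dfwith (wprod^~ (u ++ w)) (i := p) y) n b.
pose fM := GRing.isLinear.Build K (B p) (chain n b) *:%R f lin.
pose fL : {linear B p -> chain n b} := HB.pack f fM.
pose W k := u ++ serre_letters (i, p) (j, p) k (m - k) ++ w.
have fE k : wpure n b (W k) = fL (wprod p (W k)).
  apply: tpure_ext => l _ _; have [E|pl] := eqVneq p l.
    by subst l; rewrite dfwith_in.
  rewrite dfwith_out // /W; apply: val_inj.
  rewrite !val_wprod filter_cat3 [in RHS]filter_cat.
  rewrite [X in _ ++ X ++ _]filter_none //.
  by apply: sub_all (serre_letters_level i j p k (m - k)) => g /eqP ->.
rewrite (eq_bigr (fun k : 'I_m.+1 => fL (serre_coef D qh i m k *: wprod p (W k)))); last first.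
  by move=> k _; rewrite linearZ fE.
rewrite -linear_sum (_ : \sum_(k < m.+1) _ = 0) ?linear0 //; apply: val_inj.
rewrite linear_sum [RHS]linear0 /=.
pose u' := [seq g <- u | lev g == p]; pose w' := [seq g <- w | lev g == p].
transitivity (pA (word u' * level_serre D i j p * word w')); last first.
  by rewrite !rmorphM /= [pA (level_serre _ _ _ _)]presproj_rel ?mulr0 ?mul0r //; exact: Ahat_serre.
rewrite (level_serreE p erefl) mulr_sumr mulr_suml linear_sum.
apply: eq_bigr => k _ /=; rewrite -scalerAr -scalerAl linearZ /= val_wprod.
rewrite filter_cat3 (all_filterP (serre_letters_level i j p k _)).
by rewrite !word_cat mulrA.
Qed.

(** The left inverse that makes the multiplication map injective. *)
Lemma chain_section n b : exists Phi : {linear A -> chain n b},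
  forall t : chain n b, Phi (chain_mul t) = t.
Proof.
have [i j p u w ij /andP[p1 p2]|Phi PhiE] :=
  @Ahat_linear_ext I D _ (within (b - n%:Z) b) (wpure n b).
  exact: chain_serre.
exists Phi => t; elim: (tchain_words t) => [|a _ s [w /andP[ow Qw] ->] _ IH].
  by rewrite !linear0.
by rewrite !linearP /= IH chain_mul_word // PhiE.
Qed.

End Intervals.

(** * The morphism from the half quantum group *)
Section RestrictionOfScalars.
Variables (F K : comNzRingType) (iota : {rmorphism F -> K}) (M : lmodType K).

(** [M] as an F-module. The subalgebra must be seen over Q(q) for the bilinear map
    that defines a morphism on the base change. *)
Definition restrmod (f : F -> K) : Type := M.
HB.instance Definition _ := GRing.Zmodule.on (restrmod iota).

Definition restrmod_scale (a : F) (x : restrmod iota) : restrmod iota :=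
  iota a *: (x : M).
Lemma restrmod_scaleA a b x :
  restrmod_scale a (restrmod_scale b x) = restrmod_scale (a * b) x.
Proof. by rewrite /restrmod_scale rmorphM scalerA. Qed.
Lemma restrmod_scale1 : left_id 1 restrmod_scale.
Proof. by move=> x; rewrite /restrmod_scale rmorph1 scale1r. Qed.
Lemma restrmod_scaleDr : right_distributive restrmod_scale +%R.
Proof. by move=> a x y; exact: scalerDr. Qed.
Lemma restrmod_scaleDl x : {morph restrmod_scale^~ x : a b / a + b}.
Proof. by move=> a b; rewrite /restrmod_scale rmorphD scalerDl. Qed.
HB.instance Definition _ := GRing.Zmodule_isLmodule.Build F (restrmod iota)
  restrmod_scaleA restrmod_scale1 restrmod_scaleDr restrmod_scaleDl.

End RestrictionOfScalars.

Section OneLevel.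
Variables (I : choiceType) (D : root_data I) (m : int).
Notation K := Qqhalf.
Notation lev := (@lev I).
Notation U := (Uminus D).
Notation UK := (Uhalf D).
Notation A := (Ahat D).
Notation Am := (Ahat_int D m m).
Notation pA := (presproj (@Ahat_rel I D)).
Notation pU := (presproj (@Uminus_rel I D)).
Notation wordU := (word Qq).
Notation bt := (@btens _ _ qincl _ (@Uminus_rel I D)).
Notation RM := (restrmod Am qincl).

Definition at_level (w : seq I) : seq (I * int) := [seq (i, m) | i <- w].

Lemma at_level_all w : all (fun g => lev g == m) (at_level w).
Proof. by rewrite all_map; apply/allP => i _ /=. Qed.

Lemma at_levelK w : all (fun g => lev g == m) w -> at_level [seq g.1 | g <- w] = w.
Proof.
elim: w => //= -[i k] w IH /= /andP[/eqP km wm].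
by rewrite IH // -km.
Qed.

Lemma btens0 k : bt k 0 = 0.
Proof. by apply: (addrI (bt k 0)); rewrite -btensDr !addr0. Qed.

Definition lprod (w : seq I) : Am := wprod D m (at_level w).

Lemma val_lprod w : val (lprod w) = pA (word K (at_level w)).
Proof. by rewrite val_wprod (all_filterP (at_level_all w)). Qed.

Lemma lprod_cat u w : lprod (u ++ w) = lprod u * lprod w.
Proof. by apply: val_inj; rewrite rmorphM /= !val_lprod /at_level map_cat word_cat rmorphM. Qed.

Lemma lprod_nil : lprod [::] = 1.
Proof. by apply: val_inj; rewrite val_lprod word_nil rmorph1. Qed.

Lemma qincl_serre_coef i n k :
  qincl (serre_coef D q_Qq i n k) = serre_coef D qh i n k.
Proof.
have qnumE l : qincl (qint D q_Qq i l) = qint D q_Qqhalf i l.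
  have E : qincl (qi D q_Qq i) = qi D q_Qqhalf i.
    have [e _ Ee] := qexp_gt0 D i; rewrite /qi Ee.
    by rewrite -[LHS]/(qincl (q_Qq ^+ e)) rmorphXn /= qincl_q.
  by rewrite /qint fmorph_div !rmorphB /= !fmorphV !rmorphXn /= E.
have qfE l : qincl (qfact D q_Qq i l) = qfact D q_Qqhalf i l.
  by rewrite /qfact rmorph_prod; apply: eq_bigr => ? _; exact: qnumE.
by rewrite /serre_coef rmorphM rmorphXn rmorphN1 /qbinom fmorph_div rmorphM /= !qfE.
Qed.

Lemma at_level_serre i j k l :
  at_level (serre_letters i j k l) = serre_letters (i, m) (j, m) k l.
Proof. by rewrite /at_level /serre_letters /serre_letters map_cat /= !map_nseq. Qed.

(** f_i |-> f_(i,m) on the free algebra over Q(q). *)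
Definition Lfree : freealg Qq I -> RM := wext (M := RM) lprod.
HB.instance Definition _ := GRing.Linear.on Lfree.

Lemma LfreeZ a x : Lfree (a *: x) = qincl a *: (Lfree x : Am) :> Am.
Proof. exact: linearZ. Qed.

Lemma LfreeM x y : Lfree (x * y) = (Lfree x : Am) * (Lfree y : Am) :> Am.
Proof.
elim/word_ind: x => [|c u x IH].
  by rewrite mul0r linear0; exact/esym/mul0r.
rewrite mulrDl -scalerAl !(raddfD Lfree) /= LfreeZ IH.
rewrite [RHS](mulrDl (_ : Am)) LfreeZ; congr (_ + _) => {x IH}.
rewrite subalg_scalerAl; congr (_ *: _).
elim/word_ind: y => [|d w y IH].
  by rewrite mulr0 linear0; exact/esym/mulr0.
rewrite mulrDr -scalerAr !(raddfD Lfree) /= LfreeZ IH.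
rewrite [RHS](mulrDr (_ : Am)) LfreeZ; congr (_ + _).
by rewrite subalg_scalerAr -word_cat /Lfree !wext_word lprod_cat.
Qed.

Lemma Lfree_serre i j : i != j -> Lfree (serre D q_Qq (freegen Qq) i j) = 0.
Proof.
move=> ij; rewrite (serreE q_Qq id erefl) linear_sum; apply: val_inj.
transitivity (pA (level_serre D i j m)); last first.
  by apply: presproj_rel; exact: Ahat_serre.
rewrite (level_serreE m erefl) !linear_sum.
apply: eq_bigr => k _; rewrite /= LfreeZ linearZ /= qincl_serre_coef; congr (_ *: _).
by rewrite [Lfree _]wext_word val_lprod at_level_serre.
Qed.

Lemma Lfree_descends : exists phi : {linear U -> RM}, forall x, phi (pU x) = Lfree x.
Proof.
apply: quotmod_ext => _ [a [_ [b [[i j ij] ->]]]].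
rewrite [LHS]LfreeM [X in X * _]LfreeM Lfree_serre //.
by rewrite [X in X * _ = _]mulr0; exact: mul0r.
Qed.

Lemma level_morphism : exists L : {linear UK -> Am},
  monoid_morphism L /\ forall w, L (bt 1 (pU (wordU w))) = lprod w.
Proof.
have [phi phiE] := Lfree_descends.
pose f (k : restr qincl) (x : U) : RM := (k : K) *: (phi x : Am).
have fl x : linear (f^~ x).
  move=> a k k'; apply: etrans (scalerDl (phi x : Am) (a *: k : K) (k' : K)) _.
  exact: (congr1 (fun z : Am => z + f k' x) (esym (scalerA (qincl a) (k : K) (phi x : Am)))).
have fr k : linear (f k).
  move=> a x y; rewrite /f linearP scalerDr; congr (_ + _).
  apply: etrans (scalerA (k : K) (qincl a) (phi x : Am)) _.
  by rewrite mulrC; exact: esym (scalerA (qincl a) (k : K) (phi x : Am)).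
pose L (t : UK) : Am := tlift f t.
have LE k x : L (bt k x) = k *: (phi x : Am) by exact: (tliftE fl fr).
have LD s t : L (s + t) = L s + L t by exact: (tliftD fl fr).
have L0 : L 0 = 0 by exact: (tlift0 fl fr).
have LZ c t : L (c *: t) = c *: L t.
  elim/bchange_ind: t => [|k x t IH]; first by rewrite scaler0 L0 scaler0.
  rewrite scalerDr !LD IH scalerDr; congr (_ + _).
  by rewrite -[c *: _]/(bscale _ _) bscaleE !LE scalerA.
have Llin : linear L by move=> c s t; rewrite LD LZ.
have phiM x y : phi (x * y) = (phi x : Am) * (phi y : Am) :> Am.
  have [u ->] := presproj_surj x; have [v ->] := presproj_surj y.
  by rewrite -rmorphM !phiE LfreeM.
have phi_word w : phi (pU (wordU w)) = lprod w by rewrite phiE [LHS]wext_word.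
have LM s t : L (s * t) = L s * L t.
  elim/bchange_ind: s => [|k x s IHs]; first by rewrite mul0r L0 mul0r.
  rewrite mulrDl !LD IHs mulrDl; congr (_ + _) => {s IHs}.
  elim/bchange_ind: t => [|l y t IHt]; first by rewrite mulr0 L0 mulr0.
  rewrite mulrDr !LD IHt mulrDr; congr (_ + _).
  rewrite -[bt k x * _]/(bmul _ _) bmulE !LE phiM.
  by rewrite subalg_scalerAl subalg_scalerAr scalerA.
have L1 w : L (bt 1 (pU (wordU w))) = lprod w by rewrite LE scale1r phi_word.
pose LC := GRing.isLinear.Build K UK Am *:%R L Llin.
pose LL : {linear UK -> Am} := HB.pack L LC.
exists LL; split => //; split => //.
by rewrite -lprod_nil -L1 word_nil.
Qed.

Lemma Uhalf_words (t : UK) :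
  span (fun t => exists w, t = bt 1 (pU (wordU w))) t.
Proof.
elim/bchange_ind: t => [|k x t IH]; first exact: span0.
apply: spanD IH => {t}.
have -> : bt k x = k *: bt 1 x by rewrite -[k *: _]/(bscale _ _) bscaleE mulr1.
apply: spanZ; have [y ->] := presproj_surj x.
elim/word_ind: y => [|c w y IH].
  by rewrite linear0 btens0; exact: span0.
rewrite linearP btensDr btensZr mulr1; apply: spanD IH.
have -> : bt (qincl c) (pU (wordU w)) = qincl c *: bt 1 (pU (wordU w)).
  by rewrite -[_ *: _]/(bscale _ _) bscaleE mulr1.
by apply: spanZ; apply: span_incl; exists w.
Qed.

Lemma Uhalf_word_cons i w :
  bt 1 (pU (wordU (i :: w))) = Ugen D i * bt 1 (pU (wordU w)).
Proof.
rewrite -[Ugen D i * _]/(bmul _ _) /Ugen bmulE mulr1.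
by rewrite word_cons rmorphM.
Qed.

Lemma level_morphism_unique (L' : UK -> Am) : linear L' -> monoid_morphism L' ->
  (forall i, val (L' (Ugen D i)) = Agen D i m) ->
  forall w, L' (bt 1 (pU (wordU w))) = lprod w.
Proof.
move=> L'lin [L'1 L'M] L'g; elim=> [|i w IH].
  by rewrite lprod_nil word_nil rmorph1.
rewrite Uhalf_word_cons L'M IH -cat1s lprod_cat; congr (_ * _).
by apply: val_inj; rewrite L'g val_lprod word1.
Qed.

(** The left inverse that makes L_m injective. *)
Lemma level_section : exists Phi : {linear A -> UK},
  forall w, Phi (val (lprod w)) = bt 1 (pU (wordU w)).
Proof.
pose phi (w : seq (I * int)) : UK := bt 1 (pU (wordU [seq g.1 | g <- w])).
have [i j p u w ij _ n|Phi PhiE] := @Ahat_linear_ext I D UK (pred1 m) phi.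
  transitivity (bt 1 (pU (wordU [seq g.1 | g <- u] * serre D q_Qq (freegen Qq) i j
     * wordU [seq g.1 | g <- w]))); last first.
    rewrite !rmorphM /= [pU (serre _ _ _ _ _)]presproj_rel // mulr0 mul0r.
    exact: btens0.
  rewrite (serreE q_Qq id erefl) mulr_sumr mulr_suml linear_sum.
  rewrite (big_morph (bt 1) (@btensDr _ _ qincl _ (@Uminus_rel I D) 1) (btens0 1)).
  apply: eq_bigr => k _; rewrite -scalerAr -scalerAl linearZ /= btensZr mulr1.
  rewrite /= qincl_serre_coef /phi -[_ *: _]/(bscale _ _) bscaleE mulr1.
  by rewrite -!word_cat -catA !map_cat /= !map_nseq.
exists Phi => w; have wm := at_level_all w.
rewrite val_lprod PhiE ?(ordered_level wm) //.
by rewrite /phi -map_comp map_id_in.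
Qed.

End OneLevel.

Lemma level_subalgebra_iso (I : choiceType) (D : root_data I) (m : int) :
  exists L : Uhalf D -> Ahat_int D m m,
       [/\ linear L /\ GRing.monoid_morphism L,
           (forall i : I, val (L (Ugen D i)) = Agen D i m),
           (forall L' : Uhalf D -> Ahat_int D m m,
              linear L' -> GRing.monoid_morphism L' ->
              (forall i : I, val (L' (Ugen D i)) = Agen D i m) -> L' =1 L)
         & bijective L].
Proof.
have [L [LM LE]] := level_morphism D m; have [Phi PhiE] := level_section D m.
have PhiK t : Phi (val (L t)) = t.
  elim: (Uhalf_words t) => [|c _ s [w ->] _ IH]; first by rewrite !linear0.
  by rewrite !linearP /= IH LE PhiE.
exists L; split.
- by split => //; exact: linearP.
- by move=> i; have := LE [:: i]; rewrite word1 => ->; rewrite val_lprod word1.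
- move=> L' L'lin L'M L'g t; have L'E := level_morphism_unique L'lin L'M L'g.
  pose C := GRing.isLinear.Build Qqhalf (Uhalf D) (Ahat_int D m m) *:%R L' L'lin.
  pose LL : {linear Uhalf D -> Ahat_int D m m} := HB.pack L' C.
  apply: (span_linear_eq (f := LL) (g := L)) (Uhalf_words t) => _ [w ->].
  by rewrite LE -L'E.
exists (fun x => Phi (val x)) => // x.
suff [t ->] : exists t, x = L t by rewrite PhiK.
elim: (subalg_wprod x) => [|c _ y [w wm ->] _ [t ->]].
  by exists 0; rewrite linear0.
exists (c *: btens qincl 1 (presproj (@Uminus_rel I D) (word Qq [seq g.1 | g <- w])) + t).
by rewrite linearP LE /lprod at_levelK.
Qed.

Lemma ordered_product_iso (I : choiceType) (D : root_data I) (n : nat) (a b : int) :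
  a = b - n%:Z ->
  exists mu : tchain (fun k => Ahat_int D k k) n b -> Ahat_int D a b,
       [/\ linear mu,
           (forall x : (forall k : int, Ahat_int D k k),
              val (mu (tpure x n b)) =
                \prod_(0 <= r < n.+1) val (x (b - r%:Z))),
           (forall mu' : tchain (fun k => Ahat_int D k k) n b -> Ahat_int D a b,
              linear mu' ->
              (forall x : (forall k : int, Ahat_int D k k),
                 val (mu' (tpure x n b)) =
                   \prod_(0 <= r < n.+1) val (x (b - r%:Z))) ->
              mu' =1 mu)
         & bijective mu].
Proof.
move=> ->; have [Phi PhiK] := chain_section D n b.
pose mu (t : tchain (fun k => Ahat_int D k k) n b) : Ahat_int D (b - n%:Z) b :=
  Sub (chain_mul t) (chain_mul_subalg t).
have muE t : val (mu t) = chain_mul t by rewrite SubK.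
have mul : linear mu.
  by move=> c s t; apply: val_inj; rewrite [RHS]linearP muE linearP.
pose C := GRing.isLinear.Build Qqhalf _ (Ahat_int D (b - n%:Z) b) *:%R mu mul.
pose muL : {linear tchain (fun k => Ahat_int D k k) n b ->
  Ahat_int D (b - n%:Z) b} := HB.pack mu C.
exists mu; split => //.
- by move=> x; rewrite muE chain_mul_pure.
- move=> mu' mu'lin mu'E t.
  pose C' := GRing.isLinear.Build Qqhalf _ (Ahat_int D (b - n%:Z) b) *:%R mu' mu'lin.
  pose mu'L : {linear tchain (fun k => Ahat_int D k k) n b ->
    Ahat_int D (b - n%:Z) b} := HB.pack mu' C'.
  apply: (span_linear_eq (f := mu'L) (g := muL)) (tchain_words t) => _ [w _ ->].
  by apply: val_inj; rewrite [LHS]mu'E [RHS]muE chain_mul_pure.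
exists (fun x => Phi (val x)) => [t|x]; first by rewrite muE PhiK.
suff [t ->] : exists t, x = mu t by rewrite muE PhiK.
have [y oy Ey] := subalg_ordered x.
suff [t Et] : exists t : tchain (fun k => Ahat_int D k k) n b,
    chain_mul t = presproj (@Ahat_rel I D) y.
  by exists t; apply: val_inj; rewrite muE Et.
elim: oy {x Ey} => [|c _ z [w /andP[ow Qw] ->] _ [t Et]].
  by exists 0; rewrite !linear0.
exists (c *: wpure D n b w + t).
by rewrite !linearP /= Et chain_mul_word.
Qed.

Theorem corollary4p4 (I : choiceType) (D : root_data I) :
  (forall m : int,
     exists L : Uhalf D -> Ahat_int D m m,
       [/\ linear L /\ GRing.monoid_morphism L,
           (forall i : I, val (L (Ugen D i)) = Agen D i m),
           (forall L' : Uhalf D -> Ahat_int D m m,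
              linear L' -> GRing.monoid_morphism L' ->
              (forall i : I, val (L' (Ugen D i)) = Agen D i m) -> L' =1 L)
         & bijective L]) /\
  (forall a b : int, a <= b ->
     exists mu : tchain (fun k => Ahat_int D k k) (absz (b - a)) b ->
                 Ahat_int D a b,
       [/\ linear mu,
           (forall x : (forall k : int, Ahat_int D k k),
              val (mu (tpure x (absz (b - a)) b)) =
                \prod_(0 <= r < (absz (b - a)).+1) val (x (b - r%:Z))),
           (forall mu' : tchain (fun k => Ahat_int D k k) (absz (b - a)) b ->
                         Ahat_int D a b,
              linear mu' ->
              (forall x : (forall k : int, Ahat_int D k k),
                 val (mu' (tpure x (absz (b - a)) b)) =
                   \prod_(0 <= r < (absz (b - a)).+1) val (x (b - r%:Z))) ->
              mu' =1 mu)
         & bijective mu]).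
Proof.
split=> [m|a b ab]; first exact: level_subalgebra_iso.
by apply: ordered_product_iso; rewrite gez0_abs ?subr_ge0 // opprB addrC subrK.
Qed.
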